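(* (1) The first-order theory of doms of the first type (the axioms of doms plus $0=\delta$) is the universal part of the common theory of the structures $\widetilde G$, as $G$ varies among ordered abelian groups (that is, a universal sentence in the language $(\leq,0,+,-)$ holds in all $\widetilde G$ if and only if it follows from that theory). Moreover, every dom of the first type is isomorphic to a sub-dom of $\widetilde G$ for some ordered abelian group $G$. (2) The theory of doms of the second type (the pre-dom axioms, plus $\delta<0$, (MB), (MC), and $0+_R0>0$) is the universal part of the common theory of the structures $\widehat G$, as $G$ varies among discretely ordered abelian groups. Moreover, every dom of the second type is isomorphic to a sub-dom of $\widehat G$ for some discretely ordered abelian group $G$. (3) The theory of doms of the third type (the pre-dom axioms, plus $\delta<0$, (MB), (MC), and $0+_R0=0$) is the universal part of the common theory of the structures $\widehat G$, as $G$ varies among densely ordered abelian groups. Moreover, every dom of the third type is isomorphic to a sub-dom of $\widehat G$ for some densely ordered abelian group $G$.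
   Context: All orders are linear and all groups abelian; an ordered group is a linearly ordered abelian group. It is discretely ordered if it has a minimal positive element, and densely ordered if for all $x<x'$ there is $y$ with $x<y<x'$. Doms. A pre-dom is a structure $(M,\leq,0,+,-)$ (binary relation, constant, binary function, unary function) where $(M,+,0)$ is a commutative monoid with neutral element $0$, $\leq$ is a linear order with $z\leq z'\Rightarrow z+t\leq z'+t$, and the unary $-$ is an order-reversing bijection of $M$ with $-(-x)=x$ (neither $-0=0$ nor $x+(-x)=0$ is assumed). Write $x+_Ry:=-((-x)+(-y))$, $x-y:=x+_R(-y)$, $\delta:=-0$, $|x|:=\max(x,-x)$. A dom is a pre-dom satisfying for all $x,y$: (MA) $\delta\leq 0$; (MB) $|x|\geq 0$; (MC) $x\geq y$ iff $x-y\geq 0$. A sub-dom is a substructure in the language $(\leq,0,+,-)$. A dom is of the first type if $\delta=0$; of the second type if $\delta+\delta<\delta$ (equivalently $0+_R0>0$); of the third type if $\delta+\delta=\delta<0$. Cuts. A cut of $G$ is a pair $\Lambda=(\Lambda^L,\Lambda^R)$ with $G=\Lambda^L\sqcup\Lambda^R$ and every element of $\Lambda^L$ less than every element of $\Lambda^R$ (one of the two sets may be empty). $\widehat G$ is the set of cuts of $G$, with $\Lambda\leq\Gamma$ iff $\Lambda^L\subseteq\Gamma^L$; $-\Lambda:=(-\Lambda^R,-\Lambda^L)$; neutral element $0^+:=((-\infty,0],(0,+\infty))$; and $\Lambda+\Gamma$ the cut with left part $\{\lambda+\gamma:\lambda\in\Lambda^L,\gamma\in\Gamma^L\}$. $\widetilde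 G$ is the disjoint union $G\sqcup\widehat G$: order, sum and minus extend those of $G$ and of $\widehat G$; for $\gamma\in G$ and $\Lambda\in\widehat G$, $\gamma<\Lambda$ iff $\gamma\in\Lambda^L$, $\gamma>\Lambda$ iff $\gamma\in\Lambda^R$, and $\gamma+\Lambda=\Lambda+\gamma:=(\gamma+\Lambda^L,\gamma+\Lambda^R)$; the neutral element is $0\in G$. *)

(* Defs.v *)
From mathcomp Require Import all_boot all_order all_algebra.
From mathcomp Require Import boolp classical_sets.

Set Implicit Arguments.
Unset Strict Implicit.
Unset Printing Implicit Defensive.

Import Order.TTheory GRing.Theory Num.Theory.
Local Open Scope classical_set_scope.
Local Open Scope ring_scope.

Record orderedGroupType := OrderedGroup {
  og_sort :> porderZmodType;
  og_total : forall x y : og_sort, (x <= y) || (y <= x);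
  og_leD : forall z x y : og_sort, x <= y -> x + z <= y + z
}.

Definition discretely_ordered (G : orderedGroupType) : Prop :=
  exists e : G, 0 < e /\ forall x : G, 0 < x -> e <= x.

Definition densely_ordered (G : orderedGroupType) : Prop :=
  forall x x' : G, x < x' -> exists y : G, x < y /\ y < x'.

Lemma og_ltNge (G : orderedGroupType) (x y : G) : (x < y) = ~~ (y <= x).
Proof.
by rewrite lt_leAnge; case: (boolP (y <= x)); case/orP: (og_total x y) => ->;
  rewrite ?andbF.
Qed.

Lemma og_ltD (G : orderedGroupType) (z x y : G) : x < y -> z + x < z + y.
Proof.
rewrite !lt_neqAle => /andP[xy le_xy]; rewrite (inj_eq (addrI z)) xy /=.
by rewrite ![z + _]addrC; apply: og_leD.
Qed.

Lemma og_ltN (G : orderedGroupType) (x y : G) : x < y -> - y < - x.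
Proof.
move=> /(og_ltD (- x - y)); rewrite subrK.
by rewrite addrAC addNr add0r.
Qed.

Record structure := Structure {
  carrier :> Type;
  sle : carrier -> carrier -> Prop;
  szero : carrier;
  sadd : carrier -> carrier -> carrier;
  sopp : carrier -> carrier
}.

Arguments szero : clear implicits.

Definition slt (M : structure) (x y : M) : Prop := sle x y /\ x <> y.
Definition sdelta (M : structure) : M := sopp (szero M).
Definition saddR (M : structure) (x y : M) : M := sopp (sadd (sopp x) (sopp y)).
Definition ssub (M : structure) (x y : M) : M := saddR x (sopp y).
Definition smax (M : structure) (x y : M) : M := if `[< sle x y >] then y else x.
Definition sabs (M : structure) (x : M) : M := smax x (sopp x).

(* predom_oppK makes the order-reversing map sopp bijective. *)
Record is_predom (M : structure) : Prop := {
  predom_addA : associative (@sadd M);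
  predom_addC : commutative (@sadd M);
  predom_add0 : left_id (szero M) (@sadd M);
  predom_lexx : forall x : M, sle x x;
  predom_le_anti : forall x y : M, sle x y -> sle y x -> x = y;
  predom_le_trans : forall x y z : M, sle x y -> sle y z -> sle x z;
  predom_le_total : forall x y : M, sle x y \/ sle y x;
  predom_leD : forall z z' t : M, sle z z' -> sle (sadd z t) (sadd z' t);
  predom_leN : forall x y : M, sle x y -> sle (sopp y) (sopp x);
  predom_oppK : involutive (@sopp M)
}.

Record is_dom (M : structure) : Prop := {
  dom_predom : is_predom M;
  dom_MA : sle (sdelta M) (szero M);
  dom_MB : forall x : M, sle (szero M) (sabs x);
  dom_MC : forall x y : M, sle y x <-> sle (szero M) (ssub x y)
}.

Definition is_dom1 (M : structure) : Prop := is_dom M /\ sdelta M = szero M.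

Definition is_dom2 (M : structure) : Prop :=
  is_dom M /\ slt (sadd (sdelta M) (sdelta M)) (sdelta M).

Definition is_dom3 (M : structure) : Prop :=
  [/\ is_dom M, sadd (sdelta M) (sdelta M) = sdelta M
    & slt (sdelta M) (szero M)].

Record substructure (M : structure) := Substructure {
  sub_set : set M;
  sub_zero : sub_set (szero M);
  sub_add : forall x y, sub_set x -> sub_set y -> sub_set (sadd x y);
  sub_opp : forall x, sub_set x -> sub_set (sopp x)
}.

Definition sub_structure (M : structure) (A : substructure M) : structure :=
  @Structure {x : M | sub_set A x}
    (fun x y => sle (sval x) (sval y))
    (exist _ (szero M) (sub_zero A))
    (fun x y => exist _ (sadd (sval x) (sval y))
                        (sub_add (svalP x) (svalP y)))
    (fun x => exist _ (sopp (sval x)) (sub_opp (svalP x))).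

Record is_isomorphism (M N : structure) (f : M -> N) : Prop := {
  iso_bij : bijective f;
  iso_le : forall x y, sle x y <-> sle (f x) (f y);
  iso_zero : f (szero M) = szero N;
  iso_add : forall x y, f (sadd x y) = sadd (f x) (f y);
  iso_opp : forall x, f (sopp x) = sopp (f x)
}.

Definition isomorphic (M N : structure) : Prop :=
  exists f : M -> N, is_isomorphism f.

Record cut (G : orderedGroupType) := Cut {
  cutL : set G;
  cutR : set G;
  cut_cover : cutL `|` cutR = setT;
  cut_disj : cutL `&` cutR = set0;
  cut_lt : forall x y, cutL x -> cutR y -> x < y
}.

Section CutOperations.
Context {G : orderedGroupType}.
Implicit Types (L M : cut G) (g x y : G).

Lemma cutLVR L x : cutL L x \/ cutR L x.
Proof. by have : (cutL L `|` cutR L) x by rewrite cut_cover. Qed.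

Lemma cutLR L x : cutL L x -> cutR L x -> False.
Proof. by move=> /(@cut_lt _ L) Lx /Lx; rewrite ltxx. Qed.

Lemma cutL_down L x y : x <= y -> cutL L y -> cutL L x.
Proof.
move=> xy Ly; have [//|Rx] := cutLVR L x.
by have := cut_lt Ly Rx; rewrite og_ltNge xy.
Qed.

Let zeroL : set G := [set x | x <= 0].
Let zeroR : set G := [set x | 0 < x].

Fact cut_zero_cover : zeroL `|` zeroR = setT.
Proof.
apply/seteqP; split=> // x _; rewrite /zeroL /zeroR /setU /=.
by rewrite og_ltNge; case: (boolP (x <= 0)); [left|right].
Qed.

Fact cut_zero_disj : zeroL `&` zeroR = set0.
Proof.
by apply/seteqP; split=> // x []; rewrite /zeroL /zeroR /= og_ltNge => ->.
Qed.

Fact cut_zero_lt x y : zeroL x -> zeroR y -> x < y.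
Proof. exact: le_lt_trans. Qed.

(* The cut 0^+, neutral for the sum; its opposite is the cut 0^-. *)
Definition cut_zero : cut G := Cut cut_zero_cover cut_zero_disj cut_zero_lt.

Fact cut_opp_cover L : (-%R @` cutR L) `|` (-%R @` cutL L) = setT.
Proof.
apply/seteqP; split=> // x _.
by have [?|?] := cutLVR L (- x); [right|left]; exists (- x); rewrite ?opprK.
Qed.

Fact cut_opp_disj L : (-%R @` cutR L) `&` (-%R @` cutL L) = set0.
Proof.
by apply/seteqP; split=> // _ [[x Rx <-] [y Ly /oppr_inj yx]];
  apply: (@cutLR L x) => //; rewrite -yx.
Qed.

Fact cut_opp_lt L x y : (-%R @` cutR L) x -> (-%R @` cutL L) y -> x < y.
Proof. by move=> [r Rr <-] [l Ll <-]; apply/og_ltN/(cut_lt Ll). Qed.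

Definition cut_opp L : cut G :=
  Cut (cut_opp_cover L) (cut_opp_disj L) (@cut_opp_lt L).

Let addL L M : set G := [set x + y | x in cutL L & y in cutL M].

Fact cut_add_lt L M x y : addL L M x -> (~` addL L M) y -> x < y.
Proof.
move=> [l Ll [m Mm <-]] Ny; rewrite og_ltNge; apply/negP => yle; apply: Ny.
exists (y - m); last by exists m; rewrite ?subrK.
by apply: cutL_down Ll; rewrite -[l](addrK m); apply: og_leD.
Qed.

Definition cut_add L M : cut G :=
  Cut (setUv (addL L M)) (setICr (addL L M)) (@cut_add_lt L M).

Fact cut_shift_cover g L : (+%R g @` cutL L) `|` (+%R g @` cutR L) = setT.
Proof.
apply/seteqP; split=> // x _.
by have [?|?] := cutLVR L (- g + x); [left|right]; exists (- g + x);
  rewrite ?addNKr ?addKr ?addrA ?subrr ?add0r.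
Qed.

Fact cut_shift_disj g L : (+%R g @` cutL L) `&` (+%R g @` cutR L) = set0.
Proof.
by apply/seteqP; split=> // _ [[x Lx <-] [y Ry /addrI yx]];
  apply: (@cutLR L x) => //; rewrite -yx.
Qed.

Fact cut_shift_lt g L x y :
  (+%R g @` cutL L) x -> (+%R g @` cutR L) y -> x < y.
Proof. by move=> [l Ll <-] [r Rr <-]; apply/og_ltD/(cut_lt Ll). Qed.

Definition cut_shift g L : cut G :=
  Cut (cut_shift_cover g L) (cut_shift_disj g L) (@cut_shift_lt g L).

End CutOperations.

Definition cut_le (G : orderedGroupType) (L M : cut G) : Prop :=
  cutL L `<=` cutL M.

Definition hat (G : orderedGroupType) : structure :=
  @Structure (cut G) (@cut_le G) cut_zero cut_add cut_opp.

Definition tilde_le (G : orderedGroupType) (x y : G + cut G) : Prop :=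
  match x, y with
  | inl g, inl h => g <= h
  | inl g, inr M => cutL M g
  | inr L, inl h => cutR L h
  | inr L, inr M => cut_le L M
  end.

Definition tilde_add (G : orderedGroupType) (x y : G + cut G) : G + cut G :=
  match x, y with
  | inl g, inl h => inl (g + h)
  | inl g, inr L | inr L, inl g => inr (cut_shift g L)
  | inr L, inr M => inr (cut_add L M)
  end.

Definition tilde_opp (G : orderedGroupType) (x : G + cut G) : G + cut G :=
  match x with
  | inl g => inl (- g)
  | inr L => inr (cut_opp L)
  end.

Definition tilde (G : orderedGroupType) : structure :=
  @Structure (G + cut G)%type (@tilde_le G) (inl 0) (@tilde_add G) (@tilde_opp G).

Inductive term :=
  | TVar of nat
  | TZero
  | TAdd of term & term
  | TOpp of term.

Inductive formula :=
  | FEq of term & term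
  | FLe of term & term
  | FNot of formula
  | FAnd of formula & formula
  | FOr of formula & formula
  | FImp of formula & formula
  | FAll of nat & formula
  | FEx of nat & formula.

Fixpoint term_fv (t : term) : seq nat :=
  match t with
  | TVar i => [:: i]
  | TZero => [::]
  | TAdd t1 t2 => term_fv t1 ++ term_fv t2
  | TOpp t1 => term_fv t1
  end.

Fixpoint formula_fv (f : formula) : seq nat :=
  match f with
  | FEq t1 t2 | FLe t1 t2 => term_fv t1 ++ term_fv t2
  | FNot f1 => formula_fv f1
  | FAnd f1 f2 | FOr f1 f2 | FImp f1 f2 => formula_fv f1 ++ formula_fv f2
  | FAll i f1 | FEx i f1 => [seq j <- formula_fv f1 | j != i]
  end.

Definition is_sentence (f : formula) : bool := nilp (formula_fv f).

Fixpoint quantifier_free (f : formula) : bool :=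
  match f with
  | FEq _ _ | FLe _ _ => true
  | FNot f1 => quantifier_free f1
  | FAnd f1 f2 | FOr f1 f2 | FImp f1 f2 =>
      quantifier_free f1 && quantifier_free f2
  | FAll _ _ | FEx _ _ => false
  end.

Fixpoint is_universal (f : formula) : bool :=
  if f is FAll _ f1 then is_universal f1 else quantifier_free f.

Definition is_universal_sentence (f : formula) : bool :=
  is_sentence f && is_universal f.

Fixpoint eval (M : structure) (e : nat -> M) (t : term) : M :=
  match t with
  | TVar i => e i
  | TZero => szero M
  | TAdd t1 t2 => sadd (eval e t1) (eval e t2)
  | TOpp t1 => sopp (eval e t1)
  end.

Fixpoint sat (M : structure) (e : nat -> M) (f : formula) : Prop :=
  match f with
  | FEq t1 t2 => eval e t1 = eval e t2
  | FLe t1 t2 => sle (eval e t1) (eval e t2)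
  | FNot f1 => ~ sat e f1
  | FAnd f1 f2 => sat e f1 /\ sat e f2
  | FOr f1 f2 => sat e f1 \/ sat e f2
  | FImp f1 f2 => sat e f1 -> sat e f2
  | FAll i f1 => forall x : M, sat [eta e with i |-> x] f1
  | FEx i f1 => exists x : M, sat [eta e with i |-> x] f1
  end.

(* For a sentence the valuation is irrelevant. *)
Definition holds (M : structure) (f : formula) : Prop :=
  forall e : nat -> M, sat e f.

Definition models (M : structure) (T : set formula) : Prop :=
  forall f, T f -> holds M f.

Definition entails (T : set formula) (f : formula) : Prop :=
  forall M : structure, models M T -> holds M f.

(* K is a class of structures; the left-hand side says that f belongs to the
   common theory of its members. *)
Definition axiomatizes_universal_part (T : set formula)
    (K : structure -> Prop) : Prop :=
  forall f : formula, is_universal_sentence f ->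
    ((forall M : structure, K M -> holds M f) <-> entails T f).

Declare Scope fo_scope.
Delimit Scope fo_scope with F.
Bind Scope fo_scope with term.
Bind Scope fo_scope with formula.

Notation "0" := TZero : fo_scope.
Notation "s + t" := (TAdd s t) : fo_scope.
Notation "- t" := (TOpp t) : fo_scope.
Notation "s == t" := (FEq s t) : fo_scope.
Notation "s <= t" := (FLe s t) : fo_scope.
Notation "s < t" := (FAnd (FLe s t) (FNot (FEq s t))) : fo_scope.
Notation "~ f" := (FNot f) : fo_scope.
Notation "f /\ g" := (FAnd f g) : fo_scope.
Notation "f \/ g" := (FOr f g) : fo_scope.
Notation "f -> g" := (FImp f g) : fo_scope.
Notation "f <-> g" := (FAnd (FImp f g) (FImp g f)) : fo_scope.

Definition tdelta : term := (- 0)%F.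
Definition taddR (s t : term) : term := (- (- s + - t))%F.
Definition tsub (s t : term) : term := taddR s (- t)%F.

Definition forall1 (f : term -> formula) : formula :=
  FAll 0 (f (TVar 0)).
Definition forall2 (f : term -> term -> formula) : formula :=
  FAll 0 (FAll 1 (f (TVar 0) (TVar 1))).
Definition forall3 (f : term -> term -> term -> formula) : formula :=
  FAll 0 (FAll 1 (FAll 2 (f (TVar 0) (TVar 1) (TVar 2)))).

Definition predom_theory : set formula :=
  [set forall3 (fun x y z => x + (y + z) == (x + y) + z)%F;
       forall2 (fun x y => x + y == y + x)%F;
       forall1 (fun x => 0 + x == x)%F;
       forall1 (fun x => x <= x)%F;
       forall2 (fun x y => x <= y -> (y <= x -> x == y))%F;
       forall3 (fun x y z => x <= y -> (y <= z -> x <= z))%F;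
       forall2 (fun x y => x <= y \/ y <= x)%F;
       forall3 (fun z z' t => z <= z' -> z + t <= z' + t)%F;
       forall2 (fun x y => x <= y -> - y <= - x)%F;
       forall1 (fun x => - - x == x)%F].

Definition axMA : formula := (tdelta <= 0)%F.

(* |x| >= 0, with max (x, -x) unfolded. *)
Definition axMB : formula :=
  forall1 (fun x => (x <= - x -> 0 <= - x) /\ (~ (x <= - x) -> 0 <= x))%F.

Definition axMC : formula :=
  forall2 (fun x y => y <= x <-> 0 <= tsub x y)%F.

Definition dom1_theory : set formula :=
  predom_theory `|` [set axMA; axMB; axMC; (0 == tdelta)%F].

Definition dom2_theory : set formula :=
  predom_theory `|` [set (tdelta < 0)%F; axMB; axMC; (0 < taddR 0 0)%F].

Definition dom3_theory : set formula :=
  predom_theory `|` [set (tdelta < 0)%F; axMB; axMC; (taddR 0 0 == 0)%F].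

Lemma models_setU (M : structure) (T U : set formula) :
  models M (T `|` U) <-> models M T /\ models M U.
Proof.
split=> [H|[HT HU] f [/HT|/HU]//].
by split=> f ?; apply: H; [left|right].
Qed.

Lemma models_set4 (M : structure) (f g h k : formula) :
  models M [set f; g; h; k] <-> [/\ holds M f, holds M g, holds M h & holds M k].
Proof.
split=> [H|[Hf Hg Hh Hk] l [[[->|->]|->]|->] //].
by split; apply: H; rewrite /setU /=; tauto.
Qed.

Lemma predom_theoryP (M : structure) : models M predom_theory <-> is_predom M.
Proof.
split=> [H|HM f fT e].
  have get f : predom_theory f -> sat (fun=> szero M) f by move=> /H; apply.
  split.
  - by have /= := get (forall3 (fun x y z => x + (y + z) == (x + y) + z)%F);
      apply; rewrite /predom_theory /setU /=; tauto.
  - by have /= := get (forall2 (fun x y => x + y == y + x)%F);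
      apply; rewrite /predom_theory /setU /=; tauto.
  - by have /= := get (forall1 (fun x => 0 + x == x)%F);
      apply; rewrite /predom_theory /setU /=; tauto.
  - by have /= := get (forall1 (fun x => x <= x)%F);
      apply; rewrite /predom_theory /setU /=; tauto.
  - by have /= := get (forall2 (fun x y => x <= y -> (y <= x -> x == y))%F);
      apply; rewrite /predom_theory /setU /=; tauto.
  - by have /= := get
      (forall3 (fun x y z => x <= y -> (y <= z -> x <= z))%F);
      apply; rewrite /predom_theory /setU /=; tauto.
  - by have /= := get (forall2 (fun x y => x <= y \/ y <= x)%F);
      apply; rewrite /predom_theory /setU /=; tauto.
  - by have /= := get (forall3 (fun z z' t => z <= z' -> z + t <= z' + t)%F);
      apply; rewrite /predom_theory /setU /=; tauto.
  - by have /= := get (forall2 (fun x y => x <= y -> - y <= - x)%F);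
      apply; rewrite /predom_theory /setU /=; tauto.
  - by have /= := get (forall1 (fun x => - - x == x)%F);
      apply; rewrite /predom_theory /setU /=; tauto.
case: HM => *; rewrite /predom_theory /setU /= in fT.
by do 9?[case: fT => [fT|->]; last by rewrite /=]; rewrite fT /=.
Qed.

Lemma holds_axMB (M : structure) :
  holds M axMB <-> forall x : M, sle (szero M) (sabs x).
Proof.
rewrite /sabs /smax; split=> [H x|H e x /=].
  have /= [H1 H2] := H (fun=> szero M) x.
  by case: asboolP => [/H1|/H2].
by have := H x; case: asboolP.
Qed.

Lemma holds_axMC (M : structure) :
  holds M axMC <-> forall x y : M, sle y x <-> sle (szero M) (ssub x y).
Proof. by split=> [H x y|H e x y]; [apply: (H (fun=> szero M))|apply: H]. Qed.

Lemma dom1_theoryP (M : structure) : models M dom1_theory <-> is_dom1 M.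
Proof.
rewrite models_setU models_set4 predom_theoryP.
rewrite (propext (holds_axMB M)) (propext (holds_axMC M)).
split=> [[HM [MA MB MC d0]]|[[HM MA MB MC] d0]].
  by split; [split=> //; apply: (MA (fun=> szero M))
            |apply/esym/(d0 (fun=> szero M))].
by split=> //; split=> // e /=; rewrite -[RHS]d0.
Qed.

Lemma dom2_theoryP (M : structure) : models M dom2_theory <-> is_dom2 M.
Proof.
rewrite models_setU models_set4 predom_theoryP.
rewrite (propext (holds_axMB M)) (propext (holds_axMC M)).
split=> [[HM [d0 MB MC r0]]|[[HM MA MB MC] [dd dN]]].
  have [d0l d0n] := d0 (fun=> szero M); have [r0l r0n] := r0 (fun=> szero M).
  have K := predom_oppK HM.
  split; first by split.
  split; first by have := predom_leN HM r0l; rewrite /= K.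
  by move=> E; apply: r0n; rewrite /= -/(sdelta M) E K.
have K := predom_oppK HM.
split=> //; split=> // e; split=> //=.
- move=> E; apply: dN; rewrite /sdelta E; exact: predom_add0.
- by have := predom_leN HM dd; rewrite /sdelta K.
- by move=> E; apply: dN; rewrite /sdelta {3}E K.
Qed.

Lemma dom3_theoryP (M : structure) : models M dom3_theory <-> is_dom3 M.
Proof.
rewrite models_setU models_set4 predom_theoryP.
rewrite (propext (holds_axMB M)) (propext (holds_axMC M)).
split=> [[HM [d0 MB MC r0]]|[[HM MA MB MC] dd [dl dN]]].
  have [d0l d0n] := d0 (fun=> szero M); have /= r0' := r0 (fun=> szero M).
  by split; [split| rewrite /sdelta -[LHS](predom_oppK HM) r0'|split].
split=> //; split=> // e //=.
by rewrite -/(sdelta M) dd (predom_oppK HM).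
Qed.

Lemma dom_theories_universal (f : formula) :
  (dom1_theory `|` dom2_theory `|` dom3_theory) f -> is_universal_sentence f.
Proof.
have Hp g : predom_theory g -> is_universal_sentence g.
  rewrite /predom_theory /setU /= => gT.
  by do 9?[case: gT => [gT|->]; last by []]; rewrite gT.
by case=> [[]|] [/Hp //|]; case=> [[[]|]|] ->.
Qed.

(* Main.v *)
Require Import Defs.
From HB Require Import structures.
From mathcomp Require Import all_boot all_order all_algebra.
From mathcomp Require Import boolp classical_sets.

Set Implicit Arguments.
Unset Strict Implicit.
Unset Printing Implicit Defensive.

Import Order.TTheory GRing.Theory Num.Theory.
Local Open Scope classical_set_scope.
Local Open Scope ring_scope.

(**
In a dom, [y + z <= delta] iff [y <= - z], so a dom is a residuated chain. The
width [tau x = x - x] is an idempotent [>= 0], and [tau (x + y)] is the maximum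
of [tau x] and [tau y], so the dom splits into layers indexed by the widths
[w]. In a model [hat G], [w] is the cut [H^+] of a convex subgroup [H], and its
layer consists of the cuts with stabilizer [H], i.e. of cuts of [G / H]; the
layer carries an ordered group [C_w] with the subgroup [D_w] of the principal
cuts, and [x |-> x + w'] maps [C_w] to [D_w'] when [w < w'].

Conversely, [G] is rebuilt from the directed system of the [C_w] as a group of
sections with finitely many breakpoints, the sign of a section being that of
its topmost nonzero value. Between two consecutive layers a decreasing sequence
of copies of [C_w x Z] is inserted, and at its infimum the sections are required
to take values in [D_w]; this makes the quotient of [G] at a dense layer [w]
densely ordered, with the elements of [C_w \ D_w] as non-principal cuts. An
element [x] of the dom is sent to the cut of the sections lying below it. Since
residuation reduces the order to the comparison with [delta], it is enough to
check that this map is compatible with [0], [+] and [-].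
*)

(** * Ordered groups, cuts and universal sentences *)

Section OrderedGroupFacts.
Context {G : orderedGroupType}.
Implicit Types x y z : G.

Lemma og_leNgt x y : (x <= y) = ~~ (y < x).
Proof. by rewrite og_ltNge negbK. Qed.

Lemma og_leD2l z x y : (z + x <= z + y) = (x <= y).
Proof.
apply/idP/idP => [|xy]; last by rewrite ![z + _]addrC; exact: og_leD.
by move=> /(og_leD (- z)); rewrite addrAC [leRHS]addrAC subrr !add0r.
Qed.

Lemma og_subr_ge0 x y : (0 <= x - y) = (y <= x).
Proof. by rewrite -[LHS](og_leD2l y) addr0 addrC subrK. Qed.

Lemma og_addr_ge0 x y : 0 <= x -> 0 <= y -> 0 <= x + y.
Proof. by move=> x0 y0; rewrite (le_trans x0)// -{1}[x]addr0 og_leD2l. Qed.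

Lemma og_addr_gt0_ge0 x y : 0 < x -> 0 <= y -> 0 < x + y.
Proof. by move=> x0 y0; rewrite (lt_le_trans x0)// -{1}[x]addr0 og_leD2l. Qed.

Lemma og_oppr_gt0 x : (0 < - x) = (x < 0).
Proof. by apply/idP/idP => /og_ltN; rewrite ?opprK oppr0. Qed.

Lemma og_oppr_ge0 x : (0 <= - x) = (x <= 0).
Proof. by rewrite -[RHS]og_subr_ge0 sub0r. Qed.

Lemma og_oppr_le0 x : (- x <= 0) = (0 <= x).
Proof. by rewrite -[LHS]og_subr_ge0 sub0r opprK. Qed.

Lemma og_leN2 x y : (- x <= - y) = (y <= x).
Proof. by rewrite -[LHS]og_subr_ge0 opprK addrC og_subr_ge0. Qed.

Lemma og_tricho x : [\/ x = 0, 0 < x | 0 < - x].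
Proof.
rewrite og_oppr_gt0; have [->|x0] := eqVneq x 0; first exact: Or31.
by case/orP: (og_total 0 x) => x_; [apply: Or32|apply: Or33];
  rewrite lt_neqAle x_ ?andbT // eq_sym.
Qed.

End OrderedGroupFacts.

(** * Embeddings and the transfer of universal sentences *)

Section Embedding.

Record is_embedding (M N : structure) (f : M -> N) : Prop := {
  emb_le : forall x y, sle x y <-> sle (f x) (f y);
  emb_zero : f (szero M) = szero N;
  emb_add : forall x y, f (sadd x y) = sadd (f x) (f y);
  emb_opp : forall x, f (sopp x) = sopp (f x)
}.

Lemma predom_embedding_inj (M N : structure) (f : M -> N) :
  is_predom M -> is_predom N -> is_embedding f -> injective f.
Proof.
move=> HM HN Hf x y fxy; apply: (predom_le_anti HM); apply/(emb_le Hf);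
  rewrite fxy; exact: predom_lexx HN _.
Qed.

Lemma embedding_image (M N : structure) (f : M -> N) :
  is_embedding f -> injective f ->
  exists A : substructure N, isomorphic M (sub_structure A).
Proof.
move=> Hf finj.
have H0 : (range f) (szero N) by exists (szero M); rewrite ?(emb_zero Hf).
have HD x y : (range f) x -> (range f) y -> (range f) (sadd x y).
  by move=> [a _ <-] [b _ <-]; exists (sadd a b); rewrite ?(emb_add Hf).
have HN x : (range f) x -> (range f) (sopp x).
  by move=> [a _ <-]; exists (sopp a); rewrite ?(emb_opp Hf).
exists (Substructure H0 HD HN).
have Hr x : (range f) (f x) by exists x.
have val_eq (u v : {y | (range f) y}) : sval u = sval v -> u = v.
  by case: u v => [u pu] [v pv] /= E; subst v; congr exist.
exists (fun x => exist _ (f x) (Hr x) : sub_structure (Substructure H0 HD HN)).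
split.
- have pre (u : {y | (range f) y}) : {x | f x = sval u}.
    by apply: cid; case: (svalP u) => x _ <-; exists x.
  exists (fun u => sval (pre u)).
    by move=> x; apply: finj; rewrite (svalP (pre _)).
  by move=> u; apply: val_eq; rewrite /= (svalP (pre _)).
- by move=> x y; exact: emb_le Hf x y.
- by apply: val_eq; rewrite /= (emb_zero Hf).
- by move=> x y; apply: val_eq; rewrite /= (emb_add Hf).
- by move=> x; apply: val_eq; rewrite /= (emb_opp Hf).
Qed.

Lemma eval_embedding (M N : structure) (f : M -> N) (e : nat -> M) (t : term) :
  is_embedding f -> eval (f \o e) t = f (eval e t).
Proof.
move=> Hf; elim: t => //= [|s -> t ->|t ->].
- by rewrite (emb_zero Hf).
- by rewrite (emb_add Hf).
- by rewrite (emb_opp Hf).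
Qed.

Lemma sat_embedding_qf (M N : structure) (f : M -> N) (e : nat -> M) g :
  is_embedding f -> injective f -> quantifier_free g ->
  sat (f \o e) g <-> sat e g.
Proof.
move=> Hf finj; elim: g => //= [s t|s t|g IH|g IHg h IHh|g IHg h IHh|g IHg h IHh].
- by rewrite !eval_embedding //; split=> [/finj|->].
- by rewrite !eval_embedding // -(emb_le Hf).
- by move=> /IH; tauto.
- by case/andP=> /IHg + /IHh; tauto.
- by case/andP=> /IHg + /IHh; tauto.
- by case/andP=> /IHg + /IHh; tauto.
Qed.

Lemma sat_embedding_universal (M N : structure) (f : M -> N) (e : nat -> M) g :
  is_embedding f -> injective f -> is_universal g -> sat (f \o e) g -> sat e g.
Proof.
move=> Hf finj; elim: g e => [s t|s t|g _|g _ h _|g _ h _|g _ h _|i g IH|i g _] e;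
  try by move=> Hq; apply: (proj1 (sat_embedding_qf e Hf finj Hq)).
- move=> /= Hg H x; apply: IH => //.
  suff -> : f \o [eta e with i |-> x] = [eta (f \o e) with i |-> f x] by [].
  by apply: funext => j /=; case: eqP.
Qed.

(** Universal sentences descend along embeddings. Hence it suffices that the members of [K] are
    models of [T] and that every model of [T] embeds into a member of [K]. *)
Lemma universal_partP (T : set formula) (K P : structure -> Prop) :
  (forall M, models M T <-> P M) -> (forall M, P M -> is_predom M) ->
  (forall N, K N -> P N) ->
  (forall M, P M -> exists2 N, K N & exists f : M -> N, is_embedding f) ->
  axiomatizes_universal_part T K.
Proof.
move=> TP Ppre KP PK g /andP[_ gU]; split=> [H M /TP PM e|H M /KP/TP]; last exact: H.
have [N KN [f Hf]] := PK _ PM.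
have finj := predom_embedding_inj (Ppre _ PM) (Ppre _ (KP _ KN)) Hf.
exact: (sat_embedding_universal Hf finj gU (H _ KN _)).
Qed.

End Embedding.

(** Applying [sopp] turns [0 <= x - y] into [- x + y <= delta], which residuation rewrites as
    [- x <= - y]. *)
Lemma MC_of_residuation (M : structure) : is_predom M ->
  (forall y z : M, sle (sadd y z) (sdelta M) <-> sle y (sopp z)) ->
  forall x y : M, sle y x <-> sle (szero M) (ssub x y).
Proof.
move=> HM res x y; have K := predom_oppK HM; have leN := predom_leN HM.
rewrite /ssub /saddR K; split=> [/leN/res/leN|/leN]; first by rewrite /sdelta K.
by rewrite K => /res/leN; rewrite !K.
Qed.

Lemma MB_of_delta0 (M : structure) : is_predom M -> sdelta M = szero M ->
  forall x : M, sle (szero M) (sabs x).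
Proof.
move=> HM d0 x; have trans := predom_le_trans HM.
have [x0|/(predom_leN HM)] := predom_le_total HM (szero M) x.
  by rewrite /sabs /smax; case: asboolP => // /(trans _ _ _ x0).
rewrite -/(sdelta M) d0 => x0; rewrite /sabs /smax; case: asboolP => // [[]].
apply: (trans _ _ _ _ x0); have := predom_leN HM x0.
by rewrite -/(sdelta M) d0 (predom_oppK HM).
Qed.

(** * The cut structures are doms *)

Section HatDom.
Context {G : orderedGroupType}.
Implicit Types (L M N : cut G) (g h : G).

Lemma cutRE L x : cutR L x <-> ~ cutL L x.
Proof.
split=> [Rx Lx|nL]; first exact: cutLR Lx Rx.
by case: (cutLVR L x).
Qed.

Lemma cut_eq L M : (forall x, cutL L x <-> cutL M x) -> L = M.
Proof.
move=> LM.
have EL : cutL L = cutL M by apply/seteqP; split=> x /LM.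
have ER : cutR L = cutR M by apply/seteqP; split=> x /cutRE Lx; apply/cutRE; rewrite ?EL// -EL.
case: L M EL ER {LM} => [L1 R1 p1 p2 p3] [L2 R2 q1 q2 q3] /= E1 E2; subst L2 R2.
by congr Cut.
Qed.

Lemma cut_oppL L x : cutL (cut_opp L) x <-> ~ cutL L (- x).
Proof.
rewrite -cutRE; split=> [[y Ry <-]|Rx]; first by rewrite opprK.
by exists (- x); rewrite ?opprK.
Qed.

Lemma cut_addL L M x :
  cutL (cut_add L M) x <-> exists2 y, cutL L y & cutL M (x - y).
Proof.
split=> [[y Ly [z Mz <-]]|[y Ly Mz]]; first by exists y; rewrite // addrC addKr.
by exists y => //; exists (x - y); rewrite // addrC subrK.
Qed.

Lemma cut_shiftL g L x : cutL (cut_shift g L) x <-> cutL L (x - g).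
Proof.
split=> [[y Ly <-]|H]; first by rewrite addrC addKr.
by exists (x - g); rewrite // addrC subrK.
Qed.

Lemma cut_addA : associative (@cut_add G).
Proof.
move=> L M N; apply: cut_eq => x; rewrite !cut_addL.
split=> [[y Ly /cut_addL[z Mz Nz]]|[z /cut_addL[y Ly My] Nz]].
  exists (y + z); last by rewrite opprD addrA.
  by apply/cut_addL; exists y; rewrite // addrC addKr.
exists y => //; apply/cut_addL; exists (z - y) => //.
by rewrite opprB addrA subrK.
Qed.

Lemma cut_addC : commutative (@cut_add G).
Proof.
move=> L M; apply: cut_eq => x; rewrite !cut_addL.
by split=> -[y Ly My]; exists (x - y); rewrite // subKr.
Qed.

Lemma cut_add0 : left_id cut_zero (@cut_add G).
Proof.
move=> L; apply: cut_eq => x; rewrite cut_addL; split=> [[y /= y0]|Lx].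
  by apply: cutL_down; rewrite -{1}[x]addr0 og_leD2l og_oppr_ge0.
by exists 0; rewrite /= ?lexx ?subr0.
Qed.

Lemma cut_le_total L M : cut_le L M \/ cut_le M L.
Proof.
have [|/existsNP[x /not_implyP[Lx Mx]]] := pselect (cut_le L M); first by left.
by right=> y My; apply: cutL_down Lx; apply/ltW/(cut_lt My)/cutRE.
Qed.

Lemma cut_le_delta L : cut_le L (cut_opp cut_zero) <-> ~ cutL L 0.
Proof.
split=> [H /H /cut_oppL[]|L0 x Lx]; first by rewrite /= oppr0.
apply/cut_oppL => /=; rewrite og_oppr_le0 => x0.
by apply: L0; apply: cutL_down Lx.
Qed.

Lemma cut_opp_le L M : cut_le L M -> cut_le (cut_opp M) (cut_opp L).
Proof. by move=> LM x /cut_oppL H; apply/cut_oppL => /LM. Qed.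

Lemma cut_oppK : involutive (@cut_opp G).
Proof.
move=> L; apply: cut_eq => x; rewrite !cut_oppL opprK.
by split=> [/contrapT|Lx /(_ Lx)].
Qed.

(* Cut residuation; in the language of doms it says y + z <= delta iff y <= -z. *)
Lemma cut_add_delta L M :
  cut_le (cut_add L M) (cut_opp cut_zero) <-> cut_le L (cut_opp M).
Proof.
rewrite cut_le_delta cut_addL; split=> [H x Lx|H [x /H/cut_oppL + Mx]].
  by apply/cut_oppL => Mx; apply: H; exists x; rewrite // add0r.
by rewrite -[- x]add0r.
Qed.

Lemma hat_predom : is_predom (hat G).
Proof.
split=> //=.
- exact: cut_addA.
- exact: cut_addC.
- exact: cut_add0.
- by move=> L x.
- by move=> L M LM ML; apply: cut_eq => x; split=> [/LM|/ML].
- by move=> L M N LM MN x /LM/MN.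
- exact: cut_le_total.
- move=> L M N LM x /cut_addL[y /LM ? ?]; apply/cut_addL; by exists y.
- exact: cut_opp_le.
- exact: cut_oppK.
Qed.

Lemma cut_ge0 L : cut_le cut_zero L <-> cutL L 0.
Proof.
split=> [H|L0 x x0]; first by apply: H => /=.
exact: cutL_down L0.
Qed.

Lemma cut_deltaL x : cutL (cut_opp (@cut_zero G)) x <-> x < 0.
Proof. by rewrite cut_oppL /= og_oppr_le0 og_ltNge; split=> /negP. Qed.

Lemma hat_dom : is_dom (hat G).
Proof.
split; first exact: hat_predom.
- by move=> x /cut_deltaL/ltW.
- move=> L; rewrite /sabs /smax; case: asboolP => /= [LN|nLN];
    apply/cut_ge0; apply: contrapT => L0; last first.
    apply: nLN => x Lx; apply/cut_oppL => Lx'; apply: L0.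
    case/orP: (og_total 0 x) => x0; first exact: cutL_down Lx.
    by apply: cutL_down Lx'; rewrite og_oppr_ge0.
  have L0' : cutL L 0 by apply: contrapT => ?; apply: L0; apply/cut_oppL; rewrite oppr0.
  exact/L0/LN.
- apply: MC_of_residuation; first exact: hat_predom.
  exact: cut_add_delta.
Qed.

(** The least positive [e] separates [delta + delta] from [delta]: [- e] is negative but is not a
    sum of two negative elements. *)
Lemma hat_dom2 : discretely_ordered G -> is_dom2 (hat G).
Proof.
move=> [e [e0 emin]]; split; first exact: hat_dom.
split=> [x /cut_addL[y /cut_deltaL y0 /cut_deltaL xy]|E].
  apply/cut_deltaL; rewrite -(subrK y x) -og_oppr_gt0 opprD.
  by apply: og_addr_gt0_ge0; rewrite ?og_oppr_gt0 // og_oppr_ge0 ltW.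
have : cutL (sdelta (hat G)) (- e) by apply/cut_deltaL; rewrite -og_oppr_gt0 opprK.
rewrite -E => /cut_addL[y /cut_deltaL y0 /cut_deltaL].
have /emin : 0 < - y by rewrite og_oppr_gt0.
by rewrite -og_subr_ge0 addrC og_leNgt => /negbTE ->.
Qed.

(** By density every negative element is a sum of two negative ones, so [delta] is idempotent. *)
Lemma hat_dom3 : densely_ordered G -> is_dom3 (hat G).
Proof.
move=> Gd; split; first exact: hat_dom.
  apply: cut_eq => x; rewrite cut_addL cut_deltaL.
  split=> [[y /cut_deltaL y0 /cut_deltaL xy]|/Gd[y [xy y0]]].
    rewrite -(subrK y x) -og_oppr_gt0 opprD.
    by apply: og_addr_gt0_ge0; rewrite ?og_oppr_gt0 // og_oppr_ge0 ltW.
  exists y; apply/cut_deltaL => //.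
  by rewrite -(subrr y) addrC [ltRHS]addrC; apply: og_ltD.
split; first exact: dom_MA hat_dom.
move=> E; have : cutL (sdelta (hat G)) 0 by rewrite E /= lexx.
by move=> /cut_deltaL; rewrite ltxx.
Qed.

(** Sending [g] to the cut just above it respects sums and fixes the cuts. A triple sum with at
    least one cut is a cut, so [tilde_addA] reduces to [cut_addA]. *)
Definition tilde_cut (a : tilde G) : cut G :=
  match a with inl g => cut_shift g cut_zero | inr L => L end.

Lemma tilde_addE (a b : tilde G) : tilde_add a b =
  match a, b with
  | inl g, inl h => inl (g + h)
  | _, _ => inr (cut_add (tilde_cut a) (tilde_cut b))
  end.
Proof.
have shE g L : cut_shift g L = cut_add (cut_shift g cut_zero) L.
  apply: cut_eq => x; rewrite cut_shiftL cut_addL; split=> [Lx|[y]].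
    by exists g => //; apply/cut_shiftL; rewrite /= subrr.
  move=> /cut_shiftL /= yg; apply: cutL_down.
  by rewrite og_leD2l -og_subr_ge0 opprK addrC -og_oppr_le0 opprB.
case: a b => [g|L] [h|M] //=; congr inr; rewrite shE //.
exact: cut_addC.
Qed.

Lemma tilde_cutD (a b : tilde G) :
  tilde_cut (tilde_add a b) = cut_add (tilde_cut a) (tilde_cut b).
Proof.
rewrite tilde_addE; case: a b => [g|L] [h|M] //=.
apply: cut_eq => x; rewrite cut_shiftL cut_addL.
split=> [xgh|[y /cut_shiftL yg /cut_shiftL yh]]; last first.
  move: yg yh => /= yg yh.
  have -> : x - (g + h) = y - g + (x - y - h).
    by rewrite addrACA [y + _]addrC subrK -opprD.
  by rewrite -og_oppr_ge0 opprD og_addr_ge0 ?og_oppr_ge0.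
exists g; apply/cut_shiftL; rewrite /= ?subrr //.
by move: xgh; rewrite opprD addrA.
Qed.

Lemma tilde_addA : associative (@tilde_add G).
Proof.
move=> a b c.
have : tilde_cut (tilde_add a (tilde_add b c)) = tilde_cut (tilde_add (tilde_add a b) c).
  by rewrite !tilde_cutD cut_addA.
by case: a b c => [g|L] [h|M] [k|N] /= E; rewrite ?addrA //; congr inr.
Qed.

Lemma tilde_predom : is_predom (tilde G).
Proof.
split=> /=.
- exact: tilde_addA.
- by move=> [g|L] [h|M] //=; rewrite 1?addrC // cut_addC.
- move=> [g|L] /=; rewrite ?add0r //; congr inr; apply: cut_eq => x.
  by rewrite cut_shiftL subr0.
- by case=> [g|L] /=; [exact: lexx|].
- case=> [g|L] [h|M] //=.
  + by move=> gh hg; congr inl; apply/le_anti; rewrite gh.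
  + by move=> /cutLR H /H.
  + by move=> LM /cutLR/(_ LM).
  + by move=> LM ML; congr inr; apply: cut_eq => x; split=> [/LM|/ML].
- case=> [g|L] [h|M] [k|N] //=.
  + exact: le_trans.
  + by move=> gh; apply: cutL_down.
  + by move=> Mg Mk; apply/ltW/(cut_lt Mg).
  + by move=> + MN => /MN.
  + by move=> /cutRE Lh hk; apply/cutRE => Lk; apply: Lh; apply: cutL_down Lk.
  + by move=> Lh Nh x Lx; apply: cutL_down Nh; apply/ltW/(cut_lt Lx).
  + by move=> LM /cutRE Mk; apply/cutRE => /LM.
  + by move=> LM MN x /LM/MN.
- case=> [g|L] [h|M] /=.
  + by apply/orP; exact: og_total.
  + exact: cutLVR.
  + by case: (cutLVR L h); [right|left].
  + exact: cut_le_total.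
- case=> [g|L] [h|M] [k|N] //=.
  + exact: og_leD.
  + move=> gh x /cut_shiftL Nx; apply/cut_shiftL; apply: cutL_down Nx.
    by rewrite og_leD2l og_leN2.
  + by move=> Mg; exists g; rewrite // addrC.
  + by move=> Mg x /cut_shiftL Nx; apply/cut_addL; exists g.
  + by move=> Lh; exists h; rewrite // addrC.
  + move=> /cut_lt Lh x /cut_addL[y /Lh yh Nx]; apply/cut_shiftL.
    apply: cutL_down Nx.
    by rewrite og_leD2l og_leN2 ltW.
  + by move=> LM x /cut_shiftL Lx; apply/cut_shiftL/LM.
  + by move=> LM x /cut_addL[y /LM ? ?]; apply/cut_addL; exists y.
- case=> [g|L] [h|M] /=.
  + by rewrite og_leN2.
  + by move=> Mg; exists g.
  + by move=> Lh; exists h.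
  + exact: cut_opp_le.
- by case=> [g|L] /=; rewrite ?opprK ?cut_oppK.
Qed.

Lemma tilde_dom1 : is_dom1 (tilde G).
Proof.
have delta0 : sdelta (tilde G) = szero (tilde G) by rewrite /sdelta /= oppr0.
split=> //; split; first exact: tilde_predom.
- by rewrite delta0; exact: predom_lexx tilde_predom _.
- exact: MB_of_delta0 tilde_predom delta0.
- apply: MC_of_residuation; first exact: tilde_predom.
  rewrite delta0 => -[g|L] [h|M] /=.
  + by rewrite -og_subr_ge0 add0r opprD addrC og_subr_ge0.
  + split=> -[x Mx E]; exists x => //; last by rewrite -E addNr.
    by apply/eqP; rewrite eq_sym -addr_eq0 E.
  + split=> [[x Lx /eqP]|Lh]; last by exists (- h); rewrite // addrN.
    by rewrite addrC addr_eq0 => /eqP <-.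
  + by rewrite -cut_add_delta cut_le_delta.
Qed.

End HatDom.

(** * Arithmetic of doms *)

Record domType := DomType { dom_str :> structure; dom_ax : is_dom dom_str }.

(** A separate name for the carrier, to which the monoid and order instances are attached. *)
Definition dcar (D : domType) : Type := carrier (dom_str D).

Section DomInstances.
Context (D : domType).
Let HD : is_predom D := dom_predom (dom_ax D).

HB.instance Definition _ := gen_eqMixin (dcar D).
HB.instance Definition _ := gen_choiceMixin (dcar D).
HB.instance Definition _ := GRing.isNmodule.Build (dcar D)
  (predom_addA HD) (predom_addC HD) (predom_add0 HD).

Let dle (x y : dcar D) : bool := `[< sle (x : D) y >].

Fact dle_refl : reflexive dle.
Proof. by move=> x; apply/asboolP; exact: predom_lexx. Qed.

Fact dle_anti : antisymmetric dle.
Proof. by move=> x y /andP[/asboolP xy /asboolP yx]; exact: (predom_le_anti HD). Qed.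

Fact dle_trans : transitive dle.
Proof.
move=> y x z /asboolP xy /asboolP yz; apply/asboolP.
exact: predom_le_trans HD _ _ _ xy yz.
Qed.

HB.instance Definition _ := Order.Le_isPOrder.Build ring_display (dcar D)
  dle_refl dle_anti dle_trans.

Fact dle_total : total (<=%O : rel (dcar D)).
Proof.
by move=> x y; have [] := predom_le_total HD x y => ?; apply/orP; [left|right];
  apply/asboolP.
Qed.

HB.instance Definition _ := Order.POrder_isTotal.Build ring_display (dcar D)
  dle_total.

Lemma dleE (x y : dcar D) : (x <= y) = `[< sle (x : D) y >].
Proof. by []. Qed.

End DomInstances.

Definition ng {D : domType} (x : dcar D) : dcar D := @sopp D x.
Definition addR {D : domType} (x y : dcar D) : dcar D := ng (ng x + ng y).
Definition tau {D : domType} (x : dcar D) : dcar D := ng (x + ng x).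
Local Notation "x |+| y" := (addR x y) (at level 50, left associativity).

Section DomTheory.
Context {D : domType}.
Local Notation T := (dcar D).
Local Notation "0" := (@GRing.zero T).
Implicit Types x y z u v w p q : T.

Lemma ngK : involutive (@ng D).
Proof. exact: predom_oppK (dom_predom (dom_ax D)). Qed.

Lemma le_ng x y : (ng x <= ng y) = (y <= x).
Proof.
have leN (a b : T) : a <= b -> ng b <= ng a.
  by move=> /asboolP H; apply/asboolP/(predom_leN (dom_predom (dom_ax D))).
by apply/idP/idP => /leN //; rewrite !ngK.
Qed.

Lemma lt_ng x y : (ng x < ng y) = (y < x).
Proof. by rewrite !ltNge le_ng. Qed.

Lemma dom_leD2r z x y : x <= y -> x + z <= y + z.
Proof.
by move=> /asboolP H; apply/asboolP/(predom_leD (dom_predom (dom_ax D))).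
Qed.

Lemma dom_leD x y z u : x <= y -> z <= u -> x + z <= y + u.
Proof.
move=> xy zu; apply: le_trans (dom_leD2r _ xy) _.
by rewrite ![y + _]addrC dom_leD2r.
Qed.

Lemma resid x y : (x + y <= ng 0) = (x <= ng y).
Proof.
have MC (a b : T) : (b <= a) = (0 <= ng (ng a + b)).
  have := dom_MC (dom_ax D) a b; rewrite /ssub /saddR (predom_oppK (dom_predom (dom_ax D))).
  by move=> H; apply/asboolP/asboolP => /H.
by rewrite [RHS]MC ngK -[RHS]le_ng ngK addrC.
Qed.

(** This is (MB) read as a gap: nothing lies strictly between [ng 0] and [0]. *)
Lemma ge0_or x : 0 <= x \/ x <= ng 0.
Proof.
have /asboolP := dom_MB (dom_ax D) x; rewrite /sabs /smax -dleE.
case: asboolP => _; last by left.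
by move=> x0; right; rewrite -(ngK x) le_ng.
Qed.

Lemma ng0_le0 : ng 0 <= 0 :> T.
Proof. by apply/asboolP; exact: dom_MA (dom_ax D). Qed.

Lemma residR x y z : (x + y <= z) = (x <= z |+| ng y).
Proof. by rewrite /addR ngK -resid -{1}(ngK z) -resid -addrA [y + _]addrC. Qed.

Lemma addRC x y : x |+| y = y |+| x.
Proof. by rewrite /addR addrC. Qed.

Lemma addRA x y z : x |+| (y |+| z) = x |+| y |+| z.
Proof. by rewrite /addR !ngK addrA. Qed.

Lemma ngD x y : ng (x + y) = ng x |+| ng y.
Proof. by rewrite /addR !ngK. Qed.

Lemma addR_le x y z u : x <= y -> z <= u -> x |+| z <= y |+| u.
Proof. by move=> xy zu; rewrite /addR le_ng dom_leD // le_ng. Qed.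

(** Half associativity between the two sums: by residuation [z] moves to the left as [ng z], and
    [(y |+| z) + ng z <= y]. *)
Lemma add_addR_le x y z : x + (y |+| z) <= x + y |+| z.
Proof.
rewrite -{2}(ngK z) -residR -addrA dom_leD //.
by rewrite residR ngK.
Qed.

Lemma tauE x : tau x = x |+| ng x.
Proof. by rewrite /tau ngD ngK addRC. Qed.

Lemma tau_ng x : tau (ng x) = tau x.
Proof. by rewrite /tau ngK addrC. Qed.

Lemma add_ng x : x + ng x = ng (tau x).
Proof. by rewrite /tau ngK. Qed.

Lemma tau_ge0 x : 0 <= tau x.
Proof. by rewrite -le_ng /tau ngK resid ngK. Qed.

Lemma ng_tau_le x : ng (tau x) <= ng 0.
Proof. by rewrite le_ng tau_ge0. Qed.

Lemma ng_tau_le0 x : ng (tau x) <= 0.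
Proof. exact: le_trans (ng_tau_le x) ng0_le0. Qed.

(** Residuation again. This is why [tau] plays the role of a stabilizer: it is the largest element
    that [x] absorbs. *)
Lemma le_tau u x : (u <= tau x) = (u + x <= x).
Proof. by rewrite residR tauE. Qed.

Lemma add_tau x : x + tau x = x.
Proof.
apply/le_anti; rewrite addrC -le_tau lexx /= -{1}[x]add0r.
by rewrite dom_leD ?tau_ge0.
Qed.

Lemma tau_idem x : tau x + tau x = tau x.
Proof.
apply/le_anti; rewrite le_tau -addrA [_ + x]addrC add_tau addrC add_tau lexx /=.
by rewrite -{1}[tau x]add0r dom_leD ?tau_ge0.
Qed.

Lemma tau_id u : 0 <= u -> u + u = u -> tau u = u.
Proof.
move=> u0 uu; apply/le_anti; rewrite le_tau uu lexx andbT.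
by rewrite -{2}[u](add_tau u) -{1}[tau u]add0r dom_leD.
Qed.

Lemma tau0 : tau 0 = 0 :> T.
Proof. by rewrite tau_id ?addr0. Qed.

Lemma add_absorb u x : 0 <= u -> u <= tau x -> x + u = x.
Proof.
move=> u0; rewrite le_tau => ux; apply/le_anti; rewrite addrC ux /=.
by rewrite -{1}[x]add0r dom_leD.
Qed.

(** By [ge0_or], [u + ng v] is either at least 0, and then adding [u] to it shows that it is at
    least [u], or at most [ng 0], which by residuation means [u <= v]. *)
Lemma add_ng_width u v : u + u = u -> 0 <= v -> v < u -> u + ng v = u.
Proof.
move=> uu v0 vu; apply/le_anti/andP; split.
  rewrite -{2}[u]addr0 dom_leD // (le_trans _ ng0_le0) // le_ng //.
have [H|H] := ge0_or (u + ng v).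
  by rewrite -{2}uu -addrA -{1}[u]addr0 dom_leD.
by move: H; rewrite resid ngK leNgt vu.
Qed.

Lemma tau_add_ge x y : tau x <= tau (x + y).
Proof. by rewrite le_tau addrA [tau x + x]addrC add_tau. Qed.

(** If [u = tau (x + y)] exceeded both widths, it would absorb their opposites by [add_ng_width].
    But [(x + ng x) + (y + ng y)] contains [x + y] and so absorbs [u]. Hence
    [u = ng (tau x) + ng (tau y) <= 0], which is impossible. *)
Lemma tau_add x y : tau (x + y) = Order.max (tau x) (tau y).
Proof.
apply/le_anti/andP; split; last first.
  by rewrite ge_max tau_add_ge addrC tau_add_ge.
rewrite leNgt gt_max; apply/negP => /andP[xu yu].
set u := tau (x + y) in xu yu.
have uu : u + u = u by exact: tau_idem.
have E : ng (tau x) + ng (tau y) + u = ng (tau x) + ng (tau y).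
  by rewrite -!add_ng addrACA [LHS]addrAC add_tau.
have : u <= 0.
  rewrite -(add_ng_width uu (tau_ge0 x) xu) -{1}(add_ng_width uu (tau_ge0 y) yu).
  rewrite addrAC -addrA addrC E -[leRHS]addr0.
  by rewrite dom_leD ?ng_tau_le0.
by rewrite leNgt (le_lt_trans (tau_ge0 x) xu).
Qed.

Lemma tau_addR x y : tau (x |+| y) = Order.max (tau x) (tau y).
Proof. by rewrite /addR tau_ng tau_add !tau_ng. Qed.

End DomTheory.

(** * Widths and layers *)

Section Layers.
Context {D : domType}.
Local Notation T := (dcar D).
Local Notation "0" := (@GRing.zero T).
Implicit Types x y z p q : T.

Definition is_width (x : T) : bool := (0 <= x) && (x + x == x).

Record width := Width { wval :> T; widthP : is_width wval }.

HB.instance Definition _ := [isSub for wval].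
HB.instance Definition _ := [Choice of width by <:].
HB.instance Definition _ := [SubChoice_isSubOrder of width by <: with ring_display].

Fact tau_is_width x : is_width (tau x).
Proof. by rewrite /is_width tau_ge0 tau_idem eqxx. Qed.

Definition wtau x : width := Width (tau_is_width x).

Implicit Types u v w : width.
Local Notation "w ^v" := (wval w) (at level 2, format "w ^v").

Lemma width_ge0 w : 0 <= w^v :> T.
Proof. by case/andP: (widthP w). Qed.

Lemma width_idem w : w^v + w^v = w^v.
Proof. by case/andP: (widthP w) => _ /eqP. Qed.

Lemma tau_width w : tau w = w^v.
Proof. by rewrite tau_id ?width_ge0 ?width_idem. Qed.

Lemma wtau_val x w : tau x = w^v -> wtau x = w.
Proof. by move=> E; apply: val_inj. Qed.

Lemma le_width v w : (v <= w^v) = (v^v <= w^v).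
Proof. by []. Qed.

Lemma lt_width v w : (v < w) = (v^v < w^v).
Proof. by rewrite !ltNge. Qed.

Lemma ng_width_le0 w : ng w^v <= 0.
Proof. by rewrite -tau_width ng_tau_le0. Qed.

Lemma le_addR_width x w : x <= x |+| w^v.
Proof.
by rewrite -{1}(ngK x) le_ng -{2}[ng x]addr0 dom_leD ?ng_width_le0.
Qed.

Lemma le_add_width x w : x <= x + w^v.
Proof. by rewrite -{1}[x]addr0 dom_leD ?width_ge0. Qed.

Lemma add_width x w : tau x <= w^v -> tau (x + w^v) = w^v.
Proof. by move=> xw; rewrite tau_add tau_width; apply/max_idPr. Qed.

Lemma addK_width x w : tau x = w^v -> x + w^v = x.
Proof. by move=> <-; rewrite add_tau. Qed.

Lemma width_trans v w : v <= w^v -> v^v + w^v = w^v.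
Proof. by move=> vw; rewrite addrC add_absorb ?width_ge0 ?tau_width. Qed.

(** The gap [ge0_or] relative to a layer: no element of width [w] lies strictly between [ng w] and
    [w]. *)
Lemma le0_layer p w : tau p = w^v -> p < w^v -> p <= ng w.
Proof.
move=> pw plt; have [p0|] := ge0_or p.
  have : w^v + 0 <= w^v + p by rewrite dom_leD.
  by rewrite addr0 addrC addK_width // leNgt plt.
by rewrite -{1}(addK_width pw) resid.
Qed.

Lemma ge0_layer p w : tau p = w^v -> (w^v <= p) = (0 <= p).
Proof.
move=> pw; apply/idP/idP => [|p0]; first exact/le_trans/width_ge0.
by rewrite -(addK_width pw) -{1}[w^v]add0r dom_leD.
Qed.

(* w is the cut H^+ of a convex subgroup H: [dense_width w] says that G/H is
   densely ordered, [inD w] are the principal cuts (g + H)^+, and [inC w] are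
   the cuts with stabilizer H that are not of the form (g + H)^- (in the dense
   case). [inC w] is an ordered group, [inD w] a subgroup. *)
Definition dense_width w : bool := w^v |+| w^v == w^v.
(** The residual of [w] by [x], that is, the largest [y] with [x + y <= w]. *)
Definition linv w x : T := ng (x + ng w).
(** In a dense layer [x + linv w x] stays below [w] when [x] is outside [inD w], so only [|+|]
    provides inverses on all of [inC w]. In a discrete layer [w] is not neutral for [|+|]. *)
Definition ladd w x y : T := if dense_width w then x |+| y else x + y.
Definition inD w x : bool := (tau x == w^v) && (x + linv w x == w^v).
Definition inC w x : bool := (tau x == w^v) && (dense_width w ==> (x |+| w^v == x)).

Lemma linvE w x : linv w x = ng x |+| w^v.
Proof. by rewrite /linv ngD ngK. Qed.

Lemma tau_linv w x : tau x = w^v -> tau (linv w x) = w^v.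
Proof. by move=> xw; rewrite /linv tau_ng tau_add tau_ng tau_width xw maxxx. Qed.

Lemma inD_tau w x : inD w x -> tau x = w^v.
Proof. by case/andP=> /eqP. Qed.

Lemma inC_tau w x : inC w x -> tau x = w^v.
Proof. by case/andP=> /eqP. Qed.

Lemma inD_linv w x : inD w x -> x + linv w x = w^v.
Proof. by case/andP=> _ /eqP. Qed.

Lemma inC_dense w x : inC w x -> dense_width w -> x |+| w^v = x.
Proof. by case/andP=> _ /implyP H /H/eqP. Qed.

Lemma add_linv_le w x : x + linv w x <= w^v.
Proof. by rewrite addrC residR linvE addRC. Qed.

(** An inverse [y] lies below the residual [linv w x], so [x + linv w x] reaches [w] too. Thus
    [inD w] consists of the units of the layer. *)
Lemma inDP w x y : tau x = w^v -> tau y = w^v -> x + y = w^v -> inD w x.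
Proof.
move=> xw yw xy; rewrite /inD xw eqxx /=; apply/eqP/le_anti.
by rewrite add_linv_le -{1}xy dom_leD // linvE addRC -residR addrC xy lexx.
Qed.

(** If [x] is not a unit, the gap of the layer pushes [x + linv w x] down to at most [ng w]. By
    residuation [ng x |+| w = ng x], and [|+|]-adding [x] gives [w |+| w = w]. *)
Lemma notinD w x : tau x = w^v -> ~~ inD w x -> dense_width w /\ inC w (ng x).
Proof.
move=> xw; rewrite /inD xw eqxx /= => xNw.
have : x + linv w x <= ng w.
  apply: le0_layer; first by rewrite tau_add tau_linv // xw maxxx.
  by rewrite lt_neqAle xNw add_linv_le.
rewrite addrC residR -ngD addrC addK_width // linvE => le1.
have E : ng x |+| w^v = ng x by apply/le_anti; rewrite le1 le_addR_width.
have d : dense_width w.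
  apply/eqP/le_anti; rewrite le_addR_width andbT.
  by rewrite -{1}xw tauE -addRA E -tauE xw.
by rewrite d /inC tau_ng xw eqxx E eqxx implybT.
Qed.

Lemma inD_inC w x : inD w x -> inC w x.
Proof.
move=> xD; have xw := inD_tau xD; rewrite /inC xw eqxx /=; apply/implyP => /eqP d.
apply/eqP/le_anti; rewrite le_addR_width andbT.
have le1 : linv w x + (x |+| w^v) <= w^v.
  by apply: le_trans (add_addR_le _ _ _) _; rewrite addrC inD_linv ?d.
rewrite -{2}(addK_width xw); apply: le_trans (dom_leD (lexx x) le1).
by rewrite addrA inD_linv // addrC le_add_width.
Qed.

Lemma inC_discrete w x : ~~ dense_width w -> inC w x = inD w x.
Proof.
move=> nd; apply/idP/idP => [xC|]; last exact: inD_inC.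
apply: contraT => /(notinD (inC_tau xC))[]; by rewrite (negbTE nd).
Qed.

Lemma inC_width w : inC w w.
Proof. by rewrite /inC tau_width eqxx; apply/implyP. Qed.

Lemma inD_width w : inD w w.
Proof. by apply: (@inDP _ _ w); rewrite ?tau_width ?width_idem. Qed.

Lemma inC_ladd w x y : inC w x -> inC w y -> inC w (ladd w x y).
Proof.
move=> xC yC; have xw := inC_tau xC; have yw := inC_tau yC.
rewrite /inC /ladd; case: ifP => d /=.
  by rewrite tau_addR xw yw maxxx eqxx -addRA (inC_dense yC d) eqxx.
by rewrite tau_add xw yw maxxx eqxx.
Qed.

Lemma inC_linv w x : inC w x -> inC w (linv w x).
Proof.
move=> xC; have xw := inC_tau xC; rewrite /inC tau_linv // eqxx /=.
by apply/implyP => /eqP d; rewrite linvE -addRA d eqxx.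
Qed.

Lemma laddA w x y z : ladd w x (ladd w y z) = ladd w (ladd w x y) z.
Proof. by rewrite /ladd; case: dense_width; [exact: addRA|exact: addrA]. Qed.

Lemma laddC w x y : ladd w x y = ladd w y x.
Proof. by rewrite /ladd; case: ifP => _; [exact: addRC|exact: addrC]. Qed.

Lemma ladd0 w x : inC w x -> ladd w w x = x.
Proof.
move=> xC; rewrite /ladd; case: ifP => [d|_].
  by rewrite addRC (inC_dense xC d).
by rewrite addrC addK_width ?(inC_tau xC).
Qed.

Lemma laddN w x : inC w x -> ladd w (linv w x) x = w^v.
Proof.
move=> xC; rewrite laddC /ladd; case: ifP => [/eqP d|nd].
  by rewrite linvE addRA -tauE (inC_tau xC) d.
by apply: inD_linv; rewrite -inC_discrete ?nd.
Qed.

Lemma ladd_le w x y z : x <= y -> ladd w x z <= ladd w y z.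
Proof. by move=> xy; rewrite /ladd; case: ifP => _; rewrite ?addR_le ?dom_leD. Qed.

Lemma add_le_addR x y : x + y <= x |+| y.
Proof. by rewrite -{2}(ngK y) -residR -addrA add_ng -[leRHS]addr0 dom_leD ?ng_tau_le0. Qed.

(** Adding the inverse of the unit [x] to [x |+| y] gives at most [y] by [add_addR_le]. Adding [x]
    back bounds [x |+| y] by [x + y]. *)
Lemma laddE w x y : inD w x -> inC w y -> ladd w x y = x + y.
Proof.
move=> xD yC; rewrite /ladd; case: ifP => // d; apply/le_anti.
rewrite add_le_addR andbT.
have le1 : linv w x + (x |+| y) <= y.
  apply: le_trans (add_addR_le _ _ _) _.
  by rewrite addrC inD_linv // addRC (inC_dense yC d).
apply: le_trans (dom_leD (lexx x) le1).
by rewrite addrA inD_linv // addrC le_add_width.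
Qed.

Lemma inD_add w x y : inD w x -> inD w y -> inD w (x + y).
Proof.
move=> xD yD; have xw := inD_tau xD; have yw := inD_tau yD.
apply: (@inDP _ _ (linv w x + linv w y)).
- by rewrite tau_add xw yw maxxx.
- by rewrite tau_add !tau_linv // maxxx.
- by rewrite addrACA !inD_linv // width_idem.
Qed.

Lemma inD_inv w x : inD w x -> inD w (linv w x).
Proof.
move=> xD; have xw := inD_tau xD; apply: (@inDP _ _ x); rewrite ?tau_linv //.
by rewrite addrC inD_linv.
Qed.

Lemma linv_uniq w x y : inD w x -> tau y = w^v -> x + y = w^v -> y = linv w x.
Proof.
move=> xD yw xy; rewrite -(addK_width yw) -(inD_linv xD) addrA [y + x]addrC xy.
by rewrite addrC addK_width // tau_linv ?(inD_tau xD).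
Qed.

Lemma ng_add_unit w x y : inD w x -> tau y = w^v -> ng (x + y) = linv w x + ng y.
Proof.
move=> xD yw; have xw := inD_tau xD; apply/le_anti/andP; split.
  have : ng (x + y) + x <= ng y by rewrite -resid -addrA resid lexx.
  move=> /(dom_leD (lexx (linv w x))); apply: le_trans.
  rewrite addrCA [linv _ _ + x]addrC inD_linv // -/(tau y).
  by rewrite addK_width ?lexx // tau_ng tau_add xw yw maxxx.
rewrite -resid addrACA [linv _ _ + x]addrC inD_linv //.
by rewrite [ng y + y]addrC add_ng yw add_ng ng_tau_le.
Qed.

(** The inverse is [ng x + w], because [w] absorbs [ng (tau x)]. In a model, a cut whose stabilizer
    is strictly smaller than [H] falls inside a single coset of [H]. *)
Lemma inD_push x w : tau x < w^v -> inD w (x + w^v).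
Proof.
move=> xw; apply: (@inDP _ _ (ng x + w^v)).
- exact/add_width/ltW.
- by rewrite add_width // tau_ng ltW.
- by rewrite addrACA width_idem add_ng addrC add_ng_width ?tau_ge0 ?width_idem.
Qed.

Lemma push_linv x w : tau x < w^v -> linv w (x + w^v) = ng x + w^v.
Proof.
move=> xw; apply/esym/linv_uniq; first exact: inD_push.
  by rewrite add_width // tau_ng ltW.
by rewrite addrACA width_idem add_ng addrC add_ng_width ?tau_ge0 ?width_idem.
Qed.

Lemma addR_push x y w : tau x < w^v -> (x |+| y) + w^v = x + y + w^v.
Proof.
move=> xw; apply/le_anti/andP; split; last by rewrite dom_leD ?add_le_addR.
have /(dom_leD (lexx (x + w^v))) : (x |+| y) + ng x <= y.
  by rewrite residR ngK addRC lexx.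
rewrite [x + w^v + y]addrAC; apply: le_trans.
rewrite [leRHS]addrC -addrA [ng x + _]addrA [ng x + x]addrC add_ng.
by rewrite [ng (tau x) + _]addrC add_ng_width ?tau_ge0 ?width_idem.
Qed.

Lemma ladd_push v w x y : tau x < w^v -> ladd v x y + w^v = (x + w^v) + (y + w^v).
Proof.
move=> xw; rewrite addrACA width_idem /ladd; case: ifP => // _.
exact: addR_push.
Qed.

(** Here [linv w x] is [ng x] itself, so [w = x + ng x = ng w]. By [ng_width_eq] this happens only
    at width 0 and when [ng 0 = 0]. *)
Lemma inD_inC_ng w x : inD w x -> inC w (ng x) -> dense_width w -> ng w = w^v.
Proof.
move=> xD nxC d; rewrite -{2}(inD_linv xD) linvE (inC_dense nxC d).
by rewrite add_ng (inD_tau xD).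
Qed.

Lemma ng_width_eq w : ng w = w^v -> w = wtau 0 /\ ng 0 = 0 :> T.
Proof.
move=> nw; have w0 : w = 0 :> T.
  by apply/le_anti; rewrite width_ge0 andbT -{1}nw ng_width_le0.
by split; [apply: val_inj; rewrite /= tau0 | rewrite -{1}w0 nw].
Qed.

Lemma wtau0_min w : wtau 0 <= w^v.
Proof. by rewrite le_width /= tau0 width_ge0. Qed.

(* In a discrete layer, the least element above w. *)
Definition lone w : T := w^v |+| w^v.

Lemma inD_lone w : ~~ dense_width w -> inD w (lone w).
Proof.
move=> nd; rewrite -inC_discrete // /inC tau_addR tau_width maxxx eqxx /=.
by rewrite (negbTE nd).
Qed.

Lemma lone_gt w : ~~ dense_width w -> w^v < lone w.
Proof. by rewrite /dense_width lt_neqAle eq_sym le_addR_width => ->. Qed.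

Lemma lone_push v w : v < w -> lone v^v + w^v = w^v.
Proof.
rewrite lt_width => vw; rewrite /lone addR_push ?tau_width //.
by rewrite width_idem width_trans ?ltW.
Qed.

Lemma linv_lone w : ~~ dense_width w -> linv w (lone w) = ng w.
Proof.
move=> nd; have nD : inD w (ng w).
  by rewrite -inC_discrete // /inC tau_ng tau_width eqxx /= (negbTE nd).
apply/esym/linv_uniq; rewrite ?inD_lone ?tau_ng ?tau_width //.
by rewrite addrC -[RHS](inD_linv nD) linvE ngK.
Qed.

(** As [ng w] is the inverse of [lone w], [w < x] gives [ng x + lone w < w]. The gap of the layer
    improves the bound to [ng w], and residuation turns this into [lone w <= x]. *)
Lemma lone_min w x : ~~ dense_width w -> tau x = w^v -> w^v < x -> lone w^v <= x.
Proof.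
move=> nd xw wx; have nD : inD w (ng w).
  by rewrite -inC_discrete // /inC tau_ng tau_width eqxx /= (negbTE nd).
have E : ng w^v + lone w = w^v by rewrite -[RHS](inD_linv nD) linvE ngK.
have lw : tau (ng x + lone w) = w^v by rewrite tau_add tau_ng xw tau_addR tau_width !maxxx.
have : ng x + lone w^v <= ng w.
  have le1 : ng x + lone w <= w^v.
    by rewrite -[leRHS]E; apply: dom_leD; rewrite // le_ng ltW.
  apply: le0_layer => //; rewrite lt_neqAle le1 andbT.
  apply/eqP => H; move: wx; rewrite -lt_ng.
  have /(congr1 (+%R^~ (ng w))) := H; rewrite -addrA [lone w^v + _]addrC E.
  by rewrite addK_width ?tau_ng // => ->; rewrite addrC addK_width ?tau_ng ?tau_width ?ltxx.
by rewrite addrC residR ngK -{1}(ngK x) -ngD addrC addK_width ?tau_ng // !ngK.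
Qed.

End Layers.
Arguments width : clear implicits.

(** * Lexicographic limits of directed systems of ordered groups *)

(** Raw data with an order in [Prop]. Both the layer groups and the group of sections become ordered
    groups through [og_of]. *)
Record ogData := OgData {
  og_carrier : Type;
  og_zero : og_carrier;
  og_add : og_carrier -> og_carrier -> og_carrier;
  og_opp : og_carrier -> og_carrier;
  og_le : og_carrier -> og_carrier -> Prop;
  og_addA : associative og_add;
  og_addC : commutative og_add;
  og_add0 : left_id og_zero og_add;
  og_addN : left_inverse og_zero og_opp og_add;
  og_le_refl : forall x, og_le x x;
  og_le_anti : forall x y, og_le x y -> og_le y x -> x = y;
  og_le_trans : forall x y z, og_le x y -> og_le y z -> og_le x z;
  og_le_total : forall x y, og_le x y \/ og_le y x;
  og_le_add : forall z x y, og_le x y -> og_le (og_add x z) (og_add y z)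
}.

Definition og_type (d : ogData) : Type := og_carrier d.

Section OgInstances.
Context (d : ogData).

HB.instance Definition _ := gen_eqMixin (og_type d).
HB.instance Definition _ := gen_choiceMixin (og_type d).
HB.instance Definition _ := GRing.isZmodule.Build (og_type d)
  (@og_addA d) (@og_addC d) (@og_add0 d) (@og_addN d).

Let ogle (x y : og_type d) : bool := `[< og_le x y >].

Fact ogle_refl : reflexive ogle.
Proof. by move=> x; apply/asboolP; exact: og_le_refl. Qed.

Fact ogle_anti : antisymmetric ogle.
Proof. by move=> x y /andP[/asboolP xy /asboolP yx]; exact: og_le_anti. Qed.

Fact ogle_trans : transitive ogle.
Proof.
by move=> y x z /asboolP xy /asboolP yz; apply/asboolP/(og_le_trans xy yz).
Qed.

HB.instance Definition _ := Order.Le_isPOrder.Build ring_display (og_type d)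
  ogle_refl ogle_anti ogle_trans.

Lemma og_typeP (x y : og_type d) : reflect (@og_le d x y) (x <= y).
Proof. exact: asboolP. Qed.

Fact og_type_total (x y : og_type d) : (x <= y) || (y <= x).
Proof.
by have [H|H] := @og_le_total d x y; apply/orP; [left|right]; apply/og_typeP.
Qed.

Fact og_type_leD (z x y : og_type d) : x <= y -> x + z <= y + z.
Proof. by move=> /og_typeP H; apply/og_typeP; exact: og_le_add. Qed.

End OgInstances.

Definition og_of (d : ogData) : orderedGroupType :=
  OrderedGroup (@og_type_total d) (@og_type_leD d).

(** The maps exist for all pairs of indices, which avoids proof arguments, but are constrained only
    for [i <= j]. They are weakly monotone: a positive element may become 0 further up. *)
Record directed_system (disp : Order.disp_t) (I : orderType disp) := DirectedSystem {
  ds_grp :> I -> orderedGroupType;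
  ds_map : forall i j, ds_grp i -> ds_grp j;
  ds_mapD : forall i j a b, (i <= j)%O -> ds_map j (a + b) = ds_map j a + @ds_map i j b;
  ds_map_ge0 : forall i j a, (i <= j)%O -> 0 <= a -> 0 <= @ds_map i j a;
  ds_map_id : forall i a, @ds_map i i a = a;
  ds_map_comp : forall i j k a, (i <= j)%O -> (j <= k)%O ->
    @ds_map j k (@ds_map i j a) = ds_map k a
}.

(** * Tame sections and their signs *)

Definition sections disp (I : orderType disp) (S : directed_system I) : Type :=
  forall i, S i.

Section Sections.
Context {disp : Order.disp_t} {I : orderType disp} (S : directed_system I).
Implicit Types (s t : sections S) (i j k : I).

HB.instance Definition _ := gen_eqMixin (sections S).
HB.instance Definition _ := gen_choiceMixin (sections S).

Lemma sections_eq s t : (forall i, s i = t i) -> s = t.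
Proof. exact: functional_extensionality_dep. Qed.

Let sec0 : sections S := fun i => 0.
Let secD s t : sections S := fun i => s i + t i.
Let secN s : sections S := fun i => - s i.

Fact secDA : associative secD.
Proof. by move=> s t u; apply: sections_eq => i; exact: addrA. Qed.
Fact secDC : commutative secD.
Proof. by move=> s t; apply: sections_eq => i; exact: addrC. Qed.
Fact secD0 : left_id sec0 secD.
Proof. by move=> s; apply: sections_eq => i; exact: add0r. Qed.
Fact secDN : left_inverse sec0 secN secD.
Proof. by move=> s; apply: sections_eq => i; exact: addNr. Qed.

HB.instance Definition _ := GRing.isZmodule.Build (sections S)
  secDA secDC secD0 secDN.

Lemma sec_add s t i : (s + t) i = s i + t i. Proof. by []. Qed.
Lemma sec_opp s i : (- s) i = - s i. Proof. by []. Qed.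
Lemma sec_sub s t i : (s - t) i = s i - t i. Proof. by []. Qed.
Lemma sec_zero i : (0 : sections S) i = 0. Proof. by []. Qed.

Lemma ds_map0 i j : (i <= j)%O -> @ds_map _ _ S i j 0 = 0.
Proof.
move=> ij; apply: (addrI (@ds_map _ _ S i j 0)); rewrite -ds_mapD // !addr0 //.
Qed.

Lemma ds_mapN i j a : (i <= j)%O -> @ds_map _ _ S i j (- a) = - ds_map j a.
Proof.
move=> ij; apply: (addrI (ds_map j a)); rewrite -ds_mapD // !subrr ds_map0 //.
Qed.

(* The sign of a section is read off at its topmost nonzero value; [posge i]
   is the strictly positive cone modulo the sections vanishing from i on. *)
Definition posge i s : Prop :=
  exists j, [/\ (i <= j)%O, 0 < s j & forall k, (j <= k)%O -> 0 <= s k].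

(** [B] lists the breakpoints; its finiteness lets [posge_tricho] single out a topmost nonzero
    value. *)
Definition tame s : Prop :=
  exists B : seq I,
    (forall i j, (i <= j)%O -> (forall b, b \in B -> ~~ ((i < b)%O && (b <= j)%O)) ->
       s j = ds_map j (s i)) /\
    (forall j, (forall b, b \in B -> ~~ (b <= j)%O) -> s j = 0).

Lemma posge_ext i s t : (forall j, (i <= j)%O -> s j = t j) -> posge i s -> posge i t.
Proof.
move=> st [j [ij sj sk]]; exists j; split=> // [|k jk]; first by rewrite -st.
by rewrite -st ?sk // (le_trans ij).
Qed.

Lemma posge_le i j s : (i <= j)%O -> posge j s -> posge i s.
Proof. by move=> ij [k [jk sk H]]; exists k; split=> //; exact: le_trans jk. Qed.

Lemma posge_add i s t : posge i s -> posge i t -> posge i (s + t).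
Proof.
move=> [j [ij sj sH]] [k [ik tk tH]]; case: (leP j k) => jk.
- exists k; split=> // [|l kl]; rewrite sec_add.
    by rewrite addrC og_addr_gt0_ge0 ?sH.
  by rewrite og_addr_ge0 ?tH ?sH // (le_trans jk).
- exists j; split=> // [|l kl]; rewrite sec_add.
    by rewrite og_addr_gt0_ge0 ?tH // ltW.
  by rewrite og_addr_ge0 ?tH ?sH // (le_trans (ltW jk)).
Qed.

Lemma posgeN i s : posge i s -> ~ posge i (- s).
Proof.
move=> /posge_add H /H [j [_]]; by rewrite subrr sec_zero ltxx.
Qed.

Lemma posge0 i : ~ posge i 0.
Proof. by move=> [j [_]]; rewrite sec_zero ltxx. Qed.

Lemma tame0 : tame 0.
Proof. by exists [::]; split=> // i j ij _; rewrite sec_zero ds_map0. Qed.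

Lemma tameD s t : tame s -> tame t -> tame (s + t).
Proof.
move=> [B [B1 B2]] [C [C1 C2]]; exists (B ++ C); split=> [i j ij H|j H].
  rewrite !sec_add ds_mapD // -B1 -?C1 // => b bB; apply: H;
  by rewrite mem_cat bB ?orbT.
by rewrite sec_add B2 ?C2 ?addr0 // => b bB; apply: H; rewrite mem_cat bB ?orbT.
Qed.

Lemma tameN s : tame s -> tame (- s).
Proof.
move=> [B [B1 B2]]; exists B; split=> [i j ij H|j H].
  by rewrite !sec_opp ds_mapN // -B1.
by rewrite sec_opp B2 ?oppr0.
Qed.

Lemma tameB s t : tame s -> tame t -> tame (s - t).
Proof. by move=> s_ t_; apply/tameD/tameN. Qed.

Lemma seq_max (P : pred I) (B : seq I) :
  (forall b, b \in B -> ~~ P b) \/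
  (exists2 m, (m \in B) && P m & forall b, b \in B -> P b -> (b <= m)%O).
Proof.
elim: B => [|b B [IH|[m /andP[mB Pm] IH]]]; first by left.
  case: (boolP (P b)) => Pb; last first.
    by left=> c; rewrite inE => /orP[/eqP->//|/IH].
  right; exists b; first by rewrite mem_head.
  by move=> c; rewrite inE => /orP[/eqP->//|/IH/negbTE->].
right; case: (boolP (P b && (m <= b)%O)) => [/andP[Pb mb]|].
  exists b; first by rewrite mem_head.
  by move=> c; rewrite inE => /orP[/eqP->//|cB /(IH _ cB)/le_trans]; apply.
move=> nPb; exists m; first by rewrite inE mB orbT.
move=> c; rewrite inE => /orP[/eqP-> Pb|]; last exact: IH.
by move: nPb; rewrite Pb /= -ltNge => /ltW.
Qed.

(** Every value from [i] on is transported from the last point of [i :: B] before it. Let [b] be the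
    largest such point with a nonzero value: above [b] each value is 0 or the image of [s b], so
    [s b] decides the sign. *)
Lemma posge_tricho i s : tame s ->
  [\/ posge i s, posge i (- s) | forall j, (i <= j)%O -> s j = 0].
Proof.
move=> [B [B1 _]].
have val j : (i <= j)%O -> exists b, [/\ b \in i :: B, (i <= b)%O, (b <= j)%O,
     s j = ds_map j (s b) & forall c, c \in i :: B -> (c <= j)%O -> (c <= b)%O].
  move=> ij; have [/(_ i)|[b /andP[bB bj] H]] := seq_max (fun b => b <= j)%O (i :: B).
    by rewrite mem_head ij => /(_ isT).
  have ib : (i <= b)%O by apply: H; rewrite ?mem_head.
  exists b; split=> //; apply: B1 => // c cB; apply/negP => /andP[bc cj].
  by have := H c; rewrite inE cB orbT cj leNgt bc => /(_ isT isT).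
have [Z|[b /andP[bB /andP[ib sb]] H]] :=
    seq_max (fun b => (i <= b)%O && (s b != 0)) (i :: B).
  apply: Or33 => j ij; have [b [bB ib bj -> _]] := val j ij.
  by have := Z b bB; rewrite ib negbK => /eqP->; rewrite ds_map0.
have up k : (b <= k)%O -> s k = 0 \/ s k = ds_map k (s b).
  move=> bk; have [c [cB ic ck -> cmax]] := val k (le_trans ib bk).
  have bc : (b <= c)%O by apply: cmax.
  have [->|sc] := eqVneq (s c) 0; first by left; rewrite ds_map0.
  have cb : (c <= b)%O by apply: H; rewrite // ic.
  by right; have -> : c = b by apply/le_anti; rewrite cb bc.
have [sb0|sp|sn] := og_tricho (s b); first by rewrite sb0 eqxx in sb.
- apply: Or31; exists b; split=> // k bk.
  by have [->|->] := up k bk; rewrite ?lexx // ds_map_ge0 // ltW.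
- apply: Or32; exists b; split=> // k bk; rewrite sec_opp.
  by have [->|->] := up k bk; rewrite ?oppr0 ?lexx // -ds_mapN // ds_map_ge0 // ltW.
Qed.

Definition step i (a : S i) : sections S :=
  fun j => if (i <= j)%O then ds_map j a else 0.

Lemma stepE i a j : (i <= j)%O -> @step i a j = ds_map j a.
Proof. by rewrite /step => ->. Qed.

Lemma tame_step i a : tame (@step i a).
Proof.
exists [:: i]; split=> [j k jk H|k /(_ i)]; last first.
  by rewrite mem_head /step => /(_ isT)/negbTE ->.
rewrite /step; case: (leP i j) => ij; first by rewrite (le_trans ij) ?ds_map_comp.
have := H i; rewrite mem_head ij => /(_ isT) /= /negbTE ->.
by rewrite ds_map0.
Qed.

Lemma step_add i a b : @step i (a + b) = step a + step b.
Proof.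
by apply: sections_eq => j; rewrite sec_add /step; case: ifP => ij;
  rewrite ?ds_mapD ?addr0.
Qed.

Lemma step0 i : @step i 0 = 0.
Proof.
by apply: sections_eq => j; rewrite /step; case: ifP => // ij; rewrite ds_map0.
Qed.

(** The strict order modulo the sections that vanish from [i] on. *)
Definition slt i s t : Prop := posge i (t - s).

Lemma slt_irr i s : ~ slt i s s.
Proof. by rewrite /slt subrr; exact: posge0. Qed.

Lemma slt_trans i s t u : slt i s t -> slt i t u -> slt i s u.
Proof. by move=> st tu; have := posge_add tu st; rewrite addrA subrK. Qed.

Lemma slt_asym i s t : slt i s t -> ~ slt i t s.
Proof. by move=> st /(slt_trans st)/slt_irr. Qed.

Lemma slt_ext i s s' t t' :
  (forall j, (i <= j)%O -> s j = s' j) -> (forall j, (i <= j)%O -> t j = t' j) ->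
  slt i s t -> slt i s' t'.
Proof.
by move=> ss tt; apply: posge_ext => j ij; rewrite !sec_sub ss ?tt.
Qed.

Lemma slt_tricho i s t : tame s -> tame t ->
  [\/ slt i s t, slt i t s | forall j, (i <= j)%O -> s j = t j].
Proof.
move=> s_ t_; have [H|H|H] := posge_tricho i (tameB s_ t_).
- exact: Or32.
- by apply: Or31; rewrite /slt -opprB.
- by apply: Or33 => j /H; rewrite sec_sub => /subr0_eq.
Qed.

Lemma sle_slt_trans i s t u : tame s -> tame t ->
  ~ slt i t s -> slt i t u -> slt i s u.
Proof.
move=> s_ t_ nts tu; have [st|/nts//|E] := slt_tricho i s_ t_.
  exact: slt_trans tu.
by apply: slt_ext tu => // j /E ->.
Qed.

Lemma slt_sle_trans i s t u : tame t -> tame u ->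
  slt i s t -> ~ slt i u t -> slt i s u.
Proof.
move=> t_ u_ st nut; have [tu|/nut//|E] := slt_tricho i t_ u_.
  exact: slt_trans tu.
exact: slt_ext st.
Qed.

Lemma slt_add2r i u s t : slt i (s + u) (t + u) <-> slt i s t.
Proof. by rewrite /slt opprD addrACA subrr addr0. Qed.

Lemma slt_opp i s t : slt i (- s) (- t) <-> slt i t s.
Proof. by rewrite /slt opprK addrC. Qed.

Lemma slt_le i j s t : (i <= j)%O -> slt j s t -> slt i s t.
Proof. exact: posge_le. Qed.

End Sections.

(** * The ordered group of tame sections *)

Section SectionGroup.
Context {disp : Order.disp_t} {I : orderType disp} (S : directed_system I).
Context (bot : I) (bot_le : forall i, (bot <= i)%O).
Context (P : sections S -> Prop) (P_tame : forall s, P s -> tame s).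
Context (P0 : P 0) (PD : forall s t, P s -> P t -> P (s + t))
        (PN : forall s, P s -> P (- s)).

Let T := {s : sections S | P s}.
Let T_eq (s t : T) : sval s = sval t -> s = t.
Proof. by case: s t => [s ps] [t pt] /= E; subst t; congr exist. Qed.

Let Tle (s t : T) : Prop := ~ posge bot (sval s - sval t).

Let T_tame (s t : T) : tame (sval s - sval t).
Proof. by apply: tameB; apply: P_tame; exact: svalP. Qed.

Let T0 : T := exist _ 0 P0.
Let TD (s t : T) : T := exist _ (sval s + sval t) (PD (svalP s) (svalP t)).
Let TN (s : T) : T := exist _ (- sval s) (PN (svalP s)).

Fact section_addA : associative TD.
Proof. by move=> s t u; apply: T_eq; rewrite /= addrA. Qed.

Fact section_addC : commutative TD.
Proof. by move=> s t; apply: T_eq; rewrite /= addrC. Qed.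

Fact section_add0 : left_id T0 TD.
Proof. by move=> s; apply: T_eq; rewrite /= add0r. Qed.

Fact section_addN : left_inverse T0 TN TD.
Proof. by move=> s; apply: T_eq; rewrite /= addNr. Qed.

Fact section_le_refl s : Tle s s.
Proof. by rewrite /Tle subrr; exact: posge0. Qed.

Fact section_le_anti s t : Tle s t -> Tle t s -> s = t.
Proof.
move=> st ts; apply: T_eq; apply/eqP; rewrite -subr_eq0; apply/eqP.
have [/st//| |Z] := posge_tricho bot (T_tame s t); first by rewrite opprB => /ts.
by apply: sections_eq => i; exact: Z.
Qed.

Fact section_le_trans s t u : Tle s t -> Tle t u -> Tle s u.
Proof.
move=> st tu su.
have [/st//|ts|Z] := posge_tricho bot (T_tame s t).
  by apply: tu; have := posge_add ts su; rewrite opprB addrA subrK.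
apply: tu; apply: posge_ext su => i _.
by have := Z _ (bot_le i); rewrite !sec_sub => /subr0_eq ->.
Qed.

Fact section_le_total s t : Tle s t \/ Tle t s.
Proof.
rewrite /Tle; have [H|H] := pselect (posge bot (sval s - sval t)); last by left.
by right=> H'; apply: (posgeN H); rewrite opprB.
Qed.

Fact section_leD u s t : Tle s t -> Tle (TD s u) (TD t u).
Proof. by rewrite /Tle /= opprD addrACA subrr addr0. Qed.

Definition section_ogData : ogData :=
  OgData section_addA section_addC section_add0 section_addN section_le_refl
    section_le_anti section_le_trans section_le_total section_leD.

Definition section_group : orderedGroupType := og_of section_ogData.

Lemma section_leP (s t : section_group) :
  (s <= t) <-> ~ posge bot (sval (s : T) - sval (t : T)).
Proof. by split=> H; apply/(@og_typeP section_ogData). Qed.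

Lemma section_ltP (s t : section_group) :
  (s < t) <-> posge bot (sval (t : T) - sval (s : T)).
Proof.
rewrite og_ltNge; split=> [/negP|H].
  by move/section_leP/contrapT.
by apply/negP => /section_leP.
Qed.

End SectionGroup.

(** * The layer groups of a dom *)

Section LayerGroup.
Context {D : domType}.
Local Notation T := (dcar D).
Implicit Types (x y z : T) (w : width D).
Local Notation "w ^v" := (wval w) (at level 2, format "w ^v").

Lemma ladd_cancel w x z : inC w x -> inC w z -> ladd w (ladd w x z) (linv w z) = x.
Proof.
by move=> xC zC; rewrite -laddA [ladd w z _]laddC laddN // laddC ladd0.
Qed.

Lemma ladd_inj w x y z : inC w x -> inC w y -> inC w z ->
  ladd w x z = ladd w y z -> x = y.
Proof.
by move=> xC yC zC E; rewrite -(ladd_cancel xC zC) E ladd_cancel.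
Qed.

Lemma linv_le w x : inC w x -> (linv w x <= w^v) = (w^v <= x).
Proof.
move=> xC; have iC := inC_linv xC; apply/idP/idP.
  by move=> /(ladd_le w x); rewrite laddN // ladd0.
by move=> /(ladd_le w (linv w x)); rewrite ladd0 // laddC laddN.
Qed.

Section Data.
Context (w : width D).

(** The lexicographic product of [inC w] with an infinitesimal copy of the integers, used at every
    index of the layer; [principal_at_base] will force the integer to be 0 at the lowest one. *)
Let L := {p : T * int | inC w p.1}.
Let L_eq (a b : L) : sval a = sval b -> a = b.
Proof. by case: a b => [a pa] [b pb] /= E; subst b; congr exist. Qed.

Let L0 : L := exist _ (w^v, 0) (inC_width w).
Let LD (a b : L) : L :=
  exist _ (ladd w (sval a).1 (sval b).1, (sval a).2 + (sval b).2)
    (inC_ladd (svalP a) (svalP b)).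
Let LN (a : L) : L := exist _ (linv w (sval a).1, - (sval a).2) (inC_linv (svalP a)).

Let Lle (a b : L) : Prop :=
  (sval a).1 < (sval b).1 \/ (sval a).1 = (sval b).1 /\ (sval a).2 <= (sval b).2.

Fact layer_addA : associative LD.
Proof. by move=> a b c; apply: L_eq; rewrite /= laddA addrA. Qed.

Fact layer_addC : commutative LD.
Proof. by move=> a b; apply: L_eq; rewrite /= laddC addrC. Qed.

Fact layer_add0 : left_id L0 LD.
Proof.
move=> [[x k] xC]; apply: L_eq; rewrite /= add0r ladd0 //.
Qed.

Fact layer_addN : left_inverse L0 LN LD.
Proof. by move=> [[x k] xC]; apply: L_eq; rewrite /= addNr laddN. Qed.

Fact layer_le_refl a : Lle a a.
Proof. by right. Qed.

Fact layer_le_anti a b : Lle a b -> Lle b a -> a = b.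
Proof.
case: a b => [[x k] xC] [[y l] yC]; rewrite /Lle /= => H1 H2; apply: L_eq => /=.
case: H1 H2 => [xy|[-> kl]] [yx|[E lk]].
- by have := lt_trans xy yx; rewrite ltxx.
- by rewrite E ltxx in xy.
- by rewrite ltxx in yx.
- by congr pair; apply/le_anti; rewrite kl lk.
Qed.

Fact layer_le_trans a b c : Lle a b -> Lle b c -> Lle a c.
Proof.
rewrite /Lle => -[ab|[-> ab]] [bc|[E bc]].
- by left; exact: lt_trans bc.
- by left; rewrite -E.
- by left.
- by right; split=> //; exact: le_trans bc.
Qed.

Fact layer_le_total a b : Lle a b \/ Lle b a.
Proof.
rewrite /Lle; case: (ltgtP (sval a).1 (sval b).1) => H; [by do 2 left|by right; left|].
by case/orP: (le_total (sval a).2 (sval b).2) => ?; [left|right]; right.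
Qed.

Fact layer_leD c a b : Lle a b -> Lle (LD a c) (LD b c).
Proof.
case: a b c => [[x k] xC] [[y l] yC] [[z m] zC]; rewrite /Lle /=.
move=> [xy|[-> kl]]; last by right; rewrite lerD2r.
left; rewrite lt_neqAle ladd_le ?ltW // andbT; apply/eqP => /(ladd_inj xC yC zC) /= E.
by rewrite E ltxx in xy.
Qed.

Definition layer_ogData : ogData :=
  OgData layer_addA layer_addC layer_add0 layer_addN layer_le_refl
    layer_le_anti layer_le_trans layer_le_total layer_leD.

Definition layer : orderedGroupType := og_of layer_ogData.

Definition lval (a : layer) : T * int := sval (a : L).

Lemma lval_inj : injective lval.
Proof. exact: L_eq. Qed.

Lemma lvalP (a : layer) : inC w (lval a).1.
Proof. exact: svalP (a : L). Qed.

Lemma lvalD (a b : layer) :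
  lval (a + b) = (ladd w (lval a).1 (lval b).1, (lval a).2 + (lval b).2).
Proof. by []. Qed.

Lemma lval0 : lval 0 = (w^v, 0).
Proof. by []. Qed.

Lemma layer_leP (a b : layer) : (a <= b) <->
  (lval a).1 < (lval b).1 \/ (lval a).1 = (lval b).1 /\ (lval a).2 <= (lval b).2.
Proof. by split=> [/(@og_typeP layer_ogData)|H] //; apply/(@og_typeP layer_ogData). Qed.

Lemma layer_ltP (a b : layer) : (a < b) <->
  (lval a).1 < (lval b).1 \/ (lval a).1 = (lval b).1 /\ (lval a).2 < (lval b).2.
Proof.
rewrite og_ltNge; split=> [/negP H|H].
  case: (ltgtP (lval a).1 (lval b).1) => ab; [by left| |].
    by case: H; apply/layer_leP; left.
  right; split=> //; rewrite ltNge; apply/negP => ba; apply: H.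
  by apply/layer_leP; right.
apply/negP => /layer_leP; case: H => [ab|[-> kl]] [ba|[E lk]].
- by have := lt_trans ab ba; rewrite ltxx.
- by rewrite E ltxx in ab.
- by rewrite ltxx in ba.
- by have := lt_le_trans kl lk; rewrite ltxx.
Qed.

(** Total, with default value 0, so that [push] and [const] need no membership proof. *)
Definition mklayer (p : T * int) : layer :=
  if pselect (inC w p.1) is left pC then (exist _ p pC : L) else L0.

Lemma mklayerK p : inC w p.1 -> lval (mklayer p) = p.
Proof. by move=> pC; rewrite /mklayer; case: pselect. Qed.

End Data.

(* Layer w occupies the indices (w, None) < ... < (w, Some 1) < (w, Some 0). *)
Record idx := Idx { iw : width D; ik : option nat }.

HB.instance Definition _ := gen_eqMixin idx.
HB.instance Definition _ := gen_choiceMixin idx.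

Let kle (k l : option nat) : bool :=
  match k, l with
  | None, _ => true
  | Some _, None => false
  | Some m, Some n => (n <= m)%N
  end.

Let ile (i j : idx) : bool := (iw i < iw j) || ((iw i == iw j) && kle (ik i) (ik j)).

Fact ile_refl : reflexive ile.
Proof. by move=> [w [n|]]; rewrite /ile eqxx /= ?leqnn orbT. Qed.

Fact ile_anti : antisymmetric ile.
Proof.
move=> [v k] [w l]; rewrite /ile /=; case: (ltgtP v w) => //= -> /andP[kl lk].
by congr Idx; case: k l kl lk => [m|] [n|] //= nm mn; congr Some; apply: anti_leq; rewrite mn.
Qed.

Fact ile_trans : transitive ile.
Proof.
move=> [v k] [u l] [w m]; rewrite /ile /=.
case/orP=> [uv|/andP[/eqP-> kl]] /orP[vw|/andP[/eqP E lm]].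
- by rewrite (lt_trans uv vw).
- by rewrite -E uv.
- by rewrite vw.
- rewrite E eqxx; apply/orP; right; move: kl lm.
  by case: k l m => [a|] [b|] [c|] //= ab bc; exact: leq_trans ab.
Qed.

HB.instance Definition _ := Order.Le_isPOrder.Build ring_display idx
  ile_refl ile_anti ile_trans.

Fact ile_total : total (<=%O : rel idx).
Proof.
move=> [v k] [w l]; change (ile (Idx v k) (Idx w l) || ile (Idx w l) (Idx v k)).
rewrite /ile /=.
case: (ltgtP v w) => //= _.
by case: k l => [m|] [n|] //=; rewrite leq_total.
Qed.

HB.instance Definition _ := Order.POrder_isTotal.Build ring_display idx ile_total.

Implicit Types i j k : idx.

Lemma idx_leE i j :
  (i <= j) = (iw i < iw j) || ((iw i == iw j) && kle (ik i) (ik j)).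
Proof. by []. Qed.

Lemma idx_le_iw i j : i <= j -> iw i <= iw j.
Proof. by rewrite idx_leE => /orP[/ltW//|/andP[/eqP->]]. Qed.

Lemma idx_None_le w j : (Idx w None <= j) = (w <= iw j).
Proof. by rewrite idx_leE /= andbT le_eqVlt orbC. Qed.

Lemma inC_push i j x : i <= j -> inC (iw i) x -> inC (iw j) (x + (iw j)^v).
Proof.
move=> /idx_le_iw; rewrite le_eqVlt => /orP[/eqP<- xC|].
  by rewrite addK_width ?(inC_tau xC).
by rewrite lt_width => vw xC; apply/inD_inC/inD_push; rewrite (inC_tau xC).
Qed.

(** The integer is lost at every other index, even within the layer, so a 1 can be placed at one
    index without any effect above it. *)
Definition push i j (a : layer (iw i)) : layer (iw j) :=
  mklayer (iw j) ((lval a).1 + (iw j)^v, if i == j then (lval a).2 else 0).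

Lemma pushE i j a : i <= j ->
  lval (@push i j a) = ((lval a).1 + (iw j)^v, if i == j then (lval a).2 else 0).
Proof. by move=> ij; rewrite mklayerK // (inC_push ij) ?lvalP. Qed.

Fact pushD i j a b : i <= j -> push j (a + b) = push j a + @push i j b.
Proof.
move=> ij; apply: lval_inj; rewrite lvalD !pushE // lvalD /=; congr pair; last first.
  by case: ifP; rewrite ?addr0.
have aC := lvalP a; have bC := lvalP b.
move: (idx_le_iw ij); rewrite le_eqVlt => /orP[/eqP<-|].
  by rewrite !addK_width ?(inC_tau aC) ?(inC_tau bC) ?(inC_tau (inC_ladd aC bC)).
(* Once the layer changes, the image of [a] is a unit, and there [ladd] is [+]. *)
rewrite lt_width => vw.
have aD : inD (iw j) ((lval a).1 + (iw j)^v) by apply: inD_push; rewrite (inC_tau aC).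
by rewrite (laddE aD (inC_push ij bC)) ladd_push // (inC_tau aC).
Qed.

Fact push_id i a : @push i i a = a.
Proof.
apply: lval_inj; rewrite pushE // eqxx addK_width ?(inC_tau (lvalP a)) //.
by case: (lval a).
Qed.

Fact push_ge0 i j a : i <= j -> 0 <= a -> 0 <= @push i j a.
Proof.
move=> ij a0; have [E|nij] := eqVneq i j; first by subst j; rewrite push_id.
apply/layer_leP; rewrite pushE // (negbTE nij) lval0 /=.
have : (iw i)^v <= (lval a).1.
  by move/layer_leP: a0 => [/ltW//|[<-]]; rewrite lval0 lexx.
move=> /(@dom_leD2r _ (iw j)^v); rewrite width_trans ?idx_le_iw //.
by rewrite le_eqVlt => /orP[/eqP|]; [right|left].
Qed.

Fact push_comp i j k a : i <= j -> j <= k -> push k (@push i j a) = push k a.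
Proof.
move=> ij jk; apply: lval_inj; rewrite !pushE ?(le_trans ij) //=.
rewrite -addrA width_trans ?idx_le_iw //; congr pair.
have [jk'|njk] := eqVneq j k; first by subst k.
case: eqP => // E; subst k; case/eqP: njk; apply/le_anti; rewrite jk ij //.
Qed.

Definition layers : directed_system idx :=
  @DirectedSystem _ idx (fun i => layer (iw i)) push pushD push_ge0 push_id push_comp.

End LayerGroup.

Arguments idx : clear implicits.
Arguments layers : clear implicits.
Arguments Idx {D}.

(** * Comparing group elements with elements of the dom *)

Section CutRelation.
Context {D : domType}.
Local Notation T := (dcar D).
Local Notation "0" := (@GRing.zero _).
Implicit Types (x y z c : T) (v w : width D) (i j k : idx D) (s t : sections (layers D)).
Local Notation "w ^v" := (wval w) (at level 2, format "w ^v").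

Definition sval_at s i : T * int := @lval D (iw i) (s i).
Local Notation "s .@[ i ]" := (sval_at s i) (at level 1, left associativity, format "s .@[ i ]").

Lemma sval_at_inj s t i : s.@[i] = t.@[i] -> s i = t i.
Proof. exact: lval_inj. Qed.

Lemma sval_atP s i : inC (iw i) s.@[i].1.
Proof. exact: lvalP. Qed.

Lemma sval_atD s t i :
  (s + t).@[i] = (ladd (iw i) s.@[i].1 t.@[i].1, s.@[i].2 + t.@[i].2).
Proof. by []. Qed.

Lemma sval_atN s i : (- s).@[i] = (linv (iw i) s.@[i].1, - s.@[i].2).
Proof. by []. Qed.

Lemma sval_at0 i : (0 : sections (layers D)).@[i] = ((iw i)^v, 0).
Proof. by []. Qed.

Lemma sval_at_gt0 s i : (0 < s i) <->
  (iw i)^v < s.@[i].1 \/ (iw i)^v = s.@[i].1 /\ 0 < s.@[i].2.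
Proof. by rewrite layer_ltP. Qed.

Lemma sval_at_ge0 s i : (0 <= s i) <->
  (iw i)^v < s.@[i].1 \/ (iw i)^v = s.@[i].1 /\ 0 <= s.@[i].2.
Proof. by rewrite layer_leP. Qed.

Definition const i x (k : int) : sections (layers D) :=
  @step _ _ (layers D) i (mklayer (iw i) (x, k)).

Lemma tame_const i x (k : int) : tame (const i x k).
Proof. exact: tame_step. Qed.

Lemma constE i j x (k : int) : inC (iw i) x -> i <= j ->
  (const i x k).@[j] = (x + (iw j)^v, if i == j then k else 0).
Proof. by move=> xC ij; rewrite /sval_at /const stepE // pushE // mklayerK. Qed.

Lemma const_out i j x (k : int) : ~~ (i <= j) -> (const i x k).@[j] = ((iw j)^v, 0).
Proof. by move=> /negbTE ij; rewrite /sval_at /const /step ij. Qed.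

Lemma constD i x y (k l : int) : inC (iw i) x -> inC (iw i) y ->
  const i (ladd (iw i) x y) (k + l) = const i x k + const i y l.
Proof.
move=> xC yC; rewrite /const -step_add; congr step; apply: (@lval_inj _ (iw i)).
by rewrite lvalD !mklayerK // inC_ladd.
Qed.

Lemma const0 i : const i (iw i)^v 0 = 0.
Proof.
rewrite /const; have -> : mklayer (iw i) ((iw i)^v, 0) = 0.
  by apply: lval_inj; rewrite mklayerK // inC_width.
exact: step0.
Qed.

Lemma idx_lt_iw i j : iw i < iw j -> i < j.
Proof. by move=> ij; rewrite ltNge; apply/negP => /idx_le_iw; rewrite leNgt ij. Qed.

Definition base w : idx D := Idx w None.
(** For [x] in [inC w] but outside [inD w] this section is tame but not in [gsec]: it serves only as
    a bound. *)
Definition germ w x := const (base w) x 0.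

Lemma tame_germ w x : tame (germ w x).
Proof. exact: tame_const. Qed.

Lemma base_le w j : (base w <= j) = (w <= iw j).
Proof. exact: idx_None_le. Qed.

Lemma germE w x j : inC w x -> w <= iw j -> (germ w x).@[j] = (x + (iw j)^v, 0).
Proof. by move=> xC wj; rewrite constE ?base_le // if_same. Qed.

Lemma germD w x y : inC w x -> inC w y ->
  germ w (ladd w x y) = germ w x + germ w y.
Proof. by move=> xC yC; rewrite -constD // addr0. Qed.

Lemma germ0 w : germ w w^v = 0.
Proof. exact: const0. Qed.

Lemma germN w x : inC w x -> germ w (linv w x) = - germ w x.
Proof.
move=> xC; apply/eqP; rewrite -addr_eq0 -germD ?inC_linv //.
by rewrite laddN // germ0.
Qed.

Lemma posge_germ w x : inC w x -> posge (base w) (germ w x) <-> w^v < x.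
Proof.
move=> xC; split=> [[j [+ + _]]|wx].
  rewrite base_le => wj /sval_at_gt0; rewrite germE //= => -[H|[_]]; last by rewrite ltxx.
  rewrite ltNge; apply/negP => /(@dom_leD2r _ (iw j)^v).
  by rewrite width_trans // leNgt H.
exists (base w); split=> // [|k]; first apply/sval_at_gt0; last move=> H; last apply/sval_at_ge0.
  by left; rewrite germE // addK_width ?(inC_tau xC).
move: H; rewrite base_le => wk; rewrite germE //=.
have := dom_leD2r (iw k)^v (ltW wx); rewrite width_trans // le_eqVlt.
by case/orP=> [/eqP|]; [right|left].
Qed.

Lemma posge_germN w x : inC w x -> posge (base w) (- germ w x) <-> x < w^v.
Proof.
move=> xC; rewrite -germN // posge_germ ?inC_linv //.
by rewrite !ltNge linv_le.
Qed.

Lemma germ_push v w x j : v <= w -> w <= iw j -> inC v x -> inC w (x + w^v) ->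
  germ v x j = germ w (x + w^v) j.
Proof.
move=> vw wj xC xC'; apply: sval_at_inj.
by rewrite !germE ?(le_trans vw) // -addrA width_trans.
Qed.

(* The last clause leaves discrete layers without breakpoints at the inserted
   indices, which is what keeps them discrete. *)
Definition principal_at_base s : Prop := forall w,
  [/\ inD w s.@[base w].1, s.@[base w].2 = 0 &
      ~~ dense_width w -> forall n, s.@[Idx w (Some n)] = s.@[base w]].

Definition gsec s : Prop := tame s /\ principal_at_base s.

Lemma gsec_tame s : gsec s -> tame s. Proof. by case. Qed.

Lemma gsec0 : gsec 0.
Proof.
by split; [exact: tame0|move=> w; split=> //; exact: inD_width].
Qed.

Lemma gsecD s t : gsec s -> gsec t -> gsec (s + t).
Proof.
move=> [s1 s2] [t1 t2]; split; first exact: tameD.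
move=> w; have [sD sk sn] := s2 w; have [tD tk tn] := t2 w.
rewrite !sval_atD /= laddE ?inD_inC // inD_add // sk tk addr0; split=> // nd n.
by rewrite !sval_atD /= sn ?tn // sk tk addr0 laddE ?inD_inC.
Qed.

Lemma gsecN s : gsec s -> gsec (- s).
Proof.
move=> [s1 s2]; split; first exact: tameN.
move=> w; have [sD sk sn] := s2 w.
rewrite !sval_atN /= inD_inv // sk oppr0; split=> // nd n.
by rewrite !sval_atN /= sn ?sk ?oppr0.
Qed.

Lemma gsecB s t : gsec s -> gsec t -> gsec (s - t).
Proof. by move=> s_ t_; apply/gsecD/gsecN. Qed.

Lemma gsec_germ w x : inD w x -> gsec (germ w x).
Proof.
move=> xD; have xC := inD_inC xD; split; first exact: tame_germ.
move=> w'; have [ww'|ww'] := boolP (w <= w'); last first.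
  rewrite const_out ?base_le //; split=> // [|nd n]; first exact: inD_width.
  by rewrite const_out ?base_le.
rewrite germE //; split=> // [|nd n]; last by rewrite germE.
move: ww'; rewrite le_eqVlt /= => /orP[/eqP<-|]; first by rewrite addK_width ?(inC_tau xC).
by rewrite lt_width => H; apply: inD_push; rewrite (inC_tau xC).
Qed.

Lemma gsec_const w n x (k : int) : dense_width w -> inC w x -> gsec (const (Idx w (Some n)) x k).
Proof.
move=> d xC; split; first exact: tame_const.
have bleE w' : (Idx w (Some n) <= base w') = (w < w').
  by rewrite idx_leE /= andbF orbF.
move=> w'; have [ww'|ww'] := boolP (w < w'); last first.
  rewrite const_out ?bleE //; split=> // [|nd m]; first exact: inD_width.
  rewrite const_out // idx_leE /= (negbTE ww') /=.
  by apply/negP => /andP[/eqP E _]; rewrite -E d in nd.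
have E (l : option nat) : (Idx w (Some n) == Idx w' l) = false.
  by apply/negbTE/eqP => -[E _]; rewrite E ltxx in ww'.
rewrite constE ?bleE // E; split=> // [|nd m]; last by rewrite constE ?E ?idx_leE /= ?ww'.
by apply: inD_push; rewrite (inC_tau xC) -lt_width.
Qed.

(* In a dense layer [c] is approximated, modulo the sections vanishing on that
   layer, by sections of [gsec]: shorten the constant section and add a 1. *)
Lemma dense_approx w c d : dense_width w -> inC w c -> tame d -> d.@[base w].2 = 0 ->
  posge (base w) d ->
  exists n, posge (base w) (const (Idx w (Some n)) c 1 - germ w c) /\
            posge (base w) (d - (const (Idx w (Some n)) c 1 - germ w c)).
Proof.
move=> dw cC [B [B1 _]] d0 [i [bi di dk]].
(* The sign of [d] must be visible strictly above some inserted index of the layer. *)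
have [i' [n [bi' di' dk' ni']]] : exists i' n, [/\ base w <= i', 0 < d i',
    (forall k, i' <= k -> 0 <= d k) & Idx w (Some n) < i'].
  have [wi|] := boolP (w < iw i).
    by exists i, 0%N; split=> //; exact: idx_lt_iw.
  rewrite -leNgt => iw'; move: bi; rewrite base_le => wi.
  have E : iw i = w by apply/le_anti; rewrite iw' wi.
  case: i E wi iw' di dk => v [n|] /= -> _ _ di dk {v}.
    exists (Idx w (Some n)), n.+1; split=> //; first by rewrite base_le.
    by rewrite lt_leAnge !idx_leE eqxx ltxx /= leqnSn ltnn.
  (* Now [d] is positive at the base. The inserted indices decrease to the base, so one of them
     precedes all later breakpoints. Up to there [d] keeps its first coordinate, which carries the
     positivity by [d0]. *)
  have [n Hn] : exists n, forall b, b \in B -> base w < b -> Idx w (Some n) < b.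
    elim: B {B1} => [|b B [n IH]]; first by exists 0%N.
    have [m Hm] : exists m, base w < b -> Idx w (Some m) < b.
      case: b => v [m|]; [exists m.+1|exists 0%N]; rewrite !lt_leAnge !idx_leE /=.
        rewrite !andbT andbF orbF [v == w]eq_sym; case: (ltgtP v w) => //= _.
        by rewrite leqnSn ltnn.
      by rewrite !andbT !andbF !orbF [v == w]eq_sym; case: (ltgtP v w).
    exists (maxn m n) => b'; rewrite inE => /orP[/eqP->|b'B] H.
      apply: le_lt_trans (Hm H); by rewrite idx_leE /= eqxx leq_maxl orbT.
    apply: le_lt_trans (IH _ b'B H); by rewrite idx_leE /= eqxx leq_maxr orbT.
  have bn : base w <= Idx w (Some n) by rewrite base_le.
  have ne : (base w == Idx w (Some n)) = false by apply/eqP.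
  have E : d.@[Idx w (Some n)] = (d.@[base w].1, 0).
    have := B1 _ _ bn; rewrite /sval_at => ->.
      rewrite pushE //= ne addK_width //; exact: inC_tau (sval_atP d (base w)).
    move=> b bB; apply/negP => /andP[b1 b2].
    by have := Hn _ bB b1; rewrite ltNge b2.
  exists (Idx w (Some n)), n.+1; split=> //.
  - apply/sval_at_gt0; rewrite E /=; left.
    by have [+ _] := sval_at_gt0 d (base w) => /(_ di) [//|[_]]; rewrite d0 ltxx.
  - by move=> k Hk; apply: dk; exact: le_trans Hk.
  - by rewrite lt_leAnge !idx_leE eqxx ltxx /= leqnSn ltnn.
have bn : base w <= Idx w (Some n) by rewrite base_le.
(* [e] has the value (0, 1) of the layer group at the chosen index and vanishes above it. Its sign
   is read there, while [d - e] has the sign of [d]. *)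
exists n; set e := _ - germ w c.
have e_out j : Idx w (Some n) < j -> e j = 0.
  move=> nj; have bj : base w <= j by exact: le_trans bn (ltW nj).
  apply: (@sval_at_inj e 0 j); rewrite sval_at0 /e sval_atD sval_atN.
  rewrite (@constE (Idx w (Some n))) ?ltW // germE -?base_le //=.
  by rewrite lt_eqF // subr0 laddC laddN ?(@inC_push _ (base w)).
have e_n : 0 < e (Idx w (Some n)).
  apply/sval_at_gt0; right; rewrite /e sval_atD sval_atN constE // germE //= eqxx.
  by rewrite subr0 addK_width ?(inC_tau cC) // laddC laddN.
split.
- exists (Idx w (Some n)); split=> // k.
  by rewrite le_eqVlt => /orP[/eqP<-|/e_out->]; [exact: ltW|].
- exists i'; split=> // [|k ik]; first by rewrite sec_sub e_out // subr0.
  by rewrite sec_sub e_out ?subr0 ?dk' // (lt_le_trans ni').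
Qed.

(** Equality from the base on is excluded, since the value of [s] at the base is a unit and [c] is
    not. *)
Lemma slt_gsec_generic w s c : gsec s -> inC w c -> ~~ inD w c ->
  slt (base w) s (germ w c) <-> ~ slt (base w) (germ w c) s.
Proof.
move=> sG cC cD; split=> [|H]; first exact: slt_asym.
have [//|/H//|E] := slt_tricho (base w) (gsec_tame sG) (tame_germ w c).
have [sD _ _] := sG.2 w; case/negP: cD.
move: sD; rewrite /sval_at E // -/(sval_at _ _) germE //=.
by rewrite addK_width ?(inC_tau cC).
Qed.

(** As [germ w (lone w)] vanishes above the layer, the signs of [t] and of the difference would both
    be read inside it. There [t] is constant, with a value in [inD w] above [w], hence at least
    [lone w]. *)
Lemma gsec_discrete w t : ~~ dense_width w -> gsec t -> posge (base w) t ->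
  ~ posge (base w) (germ w (lone w) - t).
Proof.
move=> nd tG [i [bi ti tk]] [j [bj uj uk]].
have loneC : inC w (lone w) by apply/inD_inC/inD_lone.
have big k : base w <= k -> 0 < germ w (lone w) k -> iw k = w.
  rewrite base_le le_eqVlt => /orP[/eqP->//|wk /sval_at_gt0].
  by rewrite germE ?ltW //= lone_push // ltxx => -[|[]]; rewrite ?ltxx.
have add_germ k : germ w (lone w) k = (germ w (lone w) - t) k + t k.
  by rewrite -sec_add subrK.
have wlast k : i <= k -> j <= k -> iw k = w -> iw i = w /\ iw j = w.
  move=> /idx_le_iw + /idx_le_iw + E; rewrite E => iw_ jw_.
  by split; apply/le_anti; rewrite -base_le ?bi ?bj ?iw_ ?jw_.
have {big} [iE jE] : iw i = w /\ iw j = w.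
  case: (leP i j) => ij.
    apply: (wlast j) => //; apply: big => //.
    by rewrite add_germ og_addr_gt0_ge0 ?tk.
  apply: (wlast i) => //; first exact: ltW.
  by apply: big => //; rewrite add_germ addrC og_addr_gt0_ge0 ?uk // ltW.
have tE l : t.@[Idx w l] = t.@[base w].
  by have [_ _ H] := tG.2 w; case: l => // n; exact: H.
have [tD tz _] := tG.2 w; have tC := inD_inC tD.
case: i iE ti {tk bi wlast} => v l /= -> /(sval_at_gt0 t (Idx w l)).1.
rewrite tE tz ltxx /= => -[wt|[]//].
case: j jE uj {uk bj} => v' l' /= -> /(sval_at_gt0 _ (Idx w l')).1.
rewrite sval_atD sval_atN tE tz germE //= oppr0 addr0 ltxx => -[|[]//].
have le1 : ladd w (lone w) (linv w t.@[base w].1) <= w^v.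
  by rewrite -[leRHS](laddN tC) [leRHS]laddC ladd_le // lone_min ?(inC_tau tC).
by rewrite addK_width ?(inC_tau loneC) // ltNge le1.
Qed.

(* [cutrel s x] says that [s] is in the left part of the cut of [x]. An [x] with
   [~~ inD w x] lies in a dense layer, where [ng x] belongs to [inC w]: it is
   described through its opposite. *)
Definition cutrel s x : Prop :=
  let w := wtau x in
  if inD w x then ~ slt (base w) (germ w x) s else slt (base w) s (- germ w (ng x)).

Lemma cutrelD w s x : inD w x -> cutrel s x <-> ~ slt (base w) (germ w x) s.
Proof. by move=> xD; rewrite /cutrel (wtau_val (inD_tau xD)) xD. Qed.

Lemma cutrelN w s x : tau x = w^v -> ~~ inD w x ->
  cutrel s x <-> slt (base w) s (- germ w (ng x)).
Proof. by move=> xw xD; rewrite /cutrel (wtau_val xw) (negbTE xD). Qed.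

Lemma cutrel_le w s t y : tau y = w^v -> tame s -> tame t ->
  ~ slt (base w) s t -> cutrel s y -> cutrel t y.
Proof.
move=> yw s_ t_ nst; have [yD|yD] := boolP (inD w y).
  rewrite !(cutrelD _ yD) => H yt; apply: H.
  exact: slt_sle_trans nst.
rewrite !(cutrelN _ yw yD) => H; exact: sle_slt_trans H.
Qed.

Lemma cutrel_shift w s x y : inD w x -> tau y = w^v ->
  cutrel s (x + y) <-> cutrel (s - germ w x) y.
Proof.
move=> xD yw; have xw := inD_tau xD; have xC := inD_inC xD.
have sE : s = (s - germ w x) + germ w x by rewrite subrK.
have [yD|yD] := boolP (inD w y).
  rewrite (cutrelD _ (inD_add xD yD)) (cutrelD _ yD) -(laddE xD (inD_inC yD)).
  by rewrite germD ?inD_inC // [in X in X <-> _]sE [germ w x + _]addrC slt_add2r.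
have xyD : ~~ inD w (x + y).
  apply: contra yD => /(inD_add (inD_inv xD)); rewrite addrA.
  by rewrite [linv w x + x]addrC inD_linv // addrC addK_width.
have [dw nyC] := notinD yw yD.
rewrite (cutrelN _ _ xyD) ?(cutrelN _ yw yD) ?tau_add ?xw ?yw ?maxxx //.
rewrite (ng_add_unit xD yw) -(laddE (inD_inv xD) nyC) germD ?inC_linv // germN // opprD opprK.
by rewrite [in X in X <-> _]sE [germ w x - _]addrC slt_add2r.
Qed.

(** The bound of the cut of [x], against which [cutrel] compares weakly when [x] is a unit and
    strictly otherwise. *)
Definition wrep x : sections (layers D) :=
  let v := wtau x in if inD v x then germ v x else - germ v (ng x).

Lemma wrep_push w x j : wtau x <= w -> inD w (x + w^v) -> w <= iw j ->
  wrep x j = germ w (x + w^v) j.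
Proof.
move=> xw xD wj; rewrite /wrep; case: ifP => [H|/negbT H].
  exact: germ_push (inD_inC H) (inD_inC xD).
have [dv nxC] := notinD (erefl : tau x = (wtau x)^v) H.
have {}xw : wtau x < w.
  rewrite lt_neqAle xw andbT; apply: contra H => /eqP E.
  by move: xD; rewrite -E addK_width.
have xw' : tau x < w^v by rewrite -[tau x]/((wtau x)^v) -lt_width.
have xC' : inC w (ng x + w^v) by apply/inD_inC/inD_push; rewrite tau_ng.
rewrite sec_opp (germ_push (ltW xw) wj nxC xC').
by rewrite -push_linv // germN ?inD_inC // sec_opp opprK.
Qed.

Lemma cutrel_wrep s x : cutrel s x -> ~ slt (base (wtau x)) (wrep x) s.
Proof. by rewrite /cutrel /wrep; case: ifP => // _; exact: slt_asym. Qed.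

Lemma cutrel_push_le w s x : wtau x <= w -> inD w (x + w^v) ->
  cutrel s x -> ~ slt (base w) (germ w (x + w^v)) s.
Proof.
move=> xw xD /cutrel_wrep H1 H2; apply: H1; apply: (@slt_le _ _ _ _ (base w)).
  by rewrite base_le.
by apply: slt_ext H2 => // j; rewrite base_le => wj; rewrite (wrep_push xw xD wj).
Qed.

(** With [cutrel_push_le], this makes [germ w (x + w)] the maximum of the cut of [x] modulo the base
    of [w]. For [x] not a unit, the witness is [- germ (ng x)] cut off below the top index of its
    layer and lowered by 1 there, which is invisible from [w] on. *)
Lemma cutrel_push_ex w x : wtau x <= w -> inD w (x + w^v) ->
  exists s, [/\ gsec s, cutrel s x & forall j, base w <= j -> s j = germ w (x + w^v) j].
Proof.
move=> xw xD; have [H|H] := boolP (inD (wtau x) x).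
  exists (germ (wtau x) x); split; first exact: gsec_germ.
    by rewrite (cutrelD _ H); exact: slt_irr.
  by move=> j; rewrite base_le => wj; rewrite -(wrep_push xw xD wj) /wrep H.
have [dv nxC] := notinD (erefl : tau x = (wtau x)^v) H.
have {}xw' : wtau x < w.
  rewrite lt_neqAle xw andbT; apply: contra H => /eqP E.
  by move: xD; rewrite -E addK_width.
set v := wtau x in H dv nxC xw xw' *.
have vE : wtau x = v by []; have xv : tau x = v^v by []; clearbody v.
have vn : base v <= Idx v (Some 0%N) by rewrite base_le.
exists (- const (Idx v (Some 0%N)) (ng x) 1); split.
- by apply/gsecN/gsec_const.
- rewrite (cutrelN _ xv H) slt_opp.
  exists (Idx v (Some 0%N)); split=> //.
    apply/sval_at_gt0; right; rewrite sval_atD sval_atN constE // germE //= eqxx.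
    by rewrite subr0 addK_width ?(inC_tau nxC) // laddC laddN.
  move=> k vk; apply/sval_at_ge0; right.
  rewrite sval_atD sval_atN constE // germE ?(idx_le_iw vk) //=.
  rewrite laddC laddN; last exact: (@inC_push _ (base v) k _ (le_trans vn vk) nxC).
  by split=> //; rewrite subr0; case: ifP.
- move=> j; rewrite base_le => wj; rewrite -(wrep_push _ xD wj) /wrep vE // (negbTE H).
  rewrite !sec_opp; congr (- _); apply: sval_at_inj.
  have vj : v < iw j := lt_le_trans xw' wj.
  rewrite constE ?(ltW (idx_lt_iw _)) // germE ?ltW //; case: eqP => // E.
  by rewrite -E ltxx in vj.
Qed.

(** Since [y] absorbs [w], [x] may be replaced by the unit [x + w], which acts by translation. This
    translation is attained by some [s] in the cut of [x] and never exceeded. *)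
Lemma cutrel_add_push w g x y : gsec g -> tau y = w^v -> wtau x <= w ->
  inD w (x + w^v) ->
  cutrel g (x + y) <-> exists s, [/\ gsec s, cutrel s x & cutrel (g - s) y].
Proof.
move=> gG yw xw xD.
have -> : x + y = x + w^v + y by rewrite -{1}(addK_width yw) [y + _]addrC addrA.
have iG := gsec_germ xD; rewrite (cutrel_shift _ xD yw); split.
  have [s [sG sx sE]] := cutrel_push_ex xw xD.
  move=> H; exists s; split=> //; apply: cutrel_le yw _ _ _ H;
    [exact: gsec_tame (gsecB _ _)|exact: gsec_tame (gsecB _ _)|].
  move=> /(@slt_ext _ _ _ _ _ (g - s) _ (g - s)) H2.
  apply: (@slt_irr _ _ _ (base w) (g - s)); apply: H2 => // j bj.
  by rewrite !sec_sub sE.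
move=> [s [sG sx]]; apply: (cutrel_le yw); try exact: gsec_tame (gsecB _ _).
have := cutrel_push_le xw xD sx; rewrite ![g - _]addrC slt_add2r slt_opp //.
Qed.

(** Both bounds are strict and add up to the bound for [x + y]; conversely, [dense_approx] splits
    the gap [d] between [g] and this bound into two positive pieces. *)
Lemma cutrel_add_dense w g x y : gsec g -> tau x = w^v -> tau y = w^v ->
  ~~ inD w x -> ~~ inD w y ->
  cutrel g (x + y) <-> exists s, [/\ gsec s, cutrel s x & cutrel (g - s) y].
Proof.
move=> gG xw yw xD yD.
have [dw nxC] := notinD xw xD; have [_ nyC] := notinD yw yD.
have nE : ng (x + y) = ladd w (ng x) (ng y) by rewrite ngD /ladd dw.
have xyw : tau (x + y) = w^v by rewrite tau_add xw yw maxxx.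
have xyD : ~~ inD w (x + y).
  apply/negP => H; case/negP: xD.
  have ngw : ng w^v = w^v by apply: inD_inC_ng H _ dw; rewrite nE inC_ladd.
  by apply: (@inDP _ _ _ (ng x)); rewrite ?tau_ng // add_ng xw.
rewrite (cutrelN _ xyw xyD) nE germD //; split=> [H|[s [sG]]]; last first.
  rewrite (cutrelN _ xw xD) (cutrelN _ yw yD) => sx sy.
  rewrite opprD -(subrK s g) addrC.
  apply: (@slt_trans _ _ _ _ _ (- germ w (ng x) + (g - s))).
    by rewrite slt_add2r.
  by rewrite ![- germ w (ng x) + _]addrC slt_add2r.
set d := - (germ w (ng x) + germ w (ng y)) - g in H.
have dE : d.@[base w].2 = 0.
  have [_ gz _] := gG.2 w.
  by rewrite /d sval_atD !sval_atN sval_atD gz !germE //= !addr0 !oppr0 addr0.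
have td : tame d.
  apply/tameB; last exact: gsec_tame.
  by apply/tameN/tameD; exact: tame_germ.
have [n [e1 e2]] := dense_approx dw nxC td dE H.
have sG := gsec_const n 1 dw nxC.
exists (- const (Idx w (Some n)) (ng x) 1); split; first exact: gsecN.
  by rewrite (cutrelN _ xw xD) slt_opp.
rewrite (cutrelN _ yw yD) /slt; apply: posge_ext e2 => j _; congr (_ j).
rewrite /d opprB opprK; set a := germ w (ng x); set b := germ w (ng y).
by rewrite addrACA [- (a + b)]opprD [- a - b + a]addrAC addNr add0r -opprD.
Qed.

Lemma cutrel_add g x y : gsec g ->
  cutrel g (x + y) <-> exists s, [/\ gsec s, cutrel s x & cutrel (g - s) y].
Proof.
move=> gG; wlog xy : x y / wtau x <= wtau y.
  move=> H; case/orP: (le_total (wtau x) (wtau y)) => [/H //|/H E].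
  rewrite addrC E; split=> -[s [sG s1 s2]]; exists (g - s);
    by rewrite subKr; split=> //; exact: gsecB.
have yw : tau y = (wtau y)^v by [].
have [H|H] := boolP (inD (wtau y) (x + (wtau y)^v)); first exact: cutrel_add_push yw _ _.
have xw : tau x = (wtau y)^v.
  apply/eqP; move: xy; rewrite le_eqVlt => /orP[/eqP E|]; first by rewrite -E.
  by rewrite lt_width => /inD_push; rewrite (negbTE H).
have xD : ~~ inD (wtau y) x by move: H; rewrite addK_width.
have [yD|yD] := boolP (inD (wtau y) y); last exact: cutrel_add_dense xw yw xD yD.
have yx : wtau y <= wtau x by rewrite le_width /= xw.
have yD' : inD (wtau x) (y + (wtau x)^v).
  by rewrite (wtau_val xw) addK_width.
have xw' : tau x = (wtau x)^v by [].
rewrite addrC (cutrel_add_push gG xw' yx yD').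
split=> -[s [sG s1 s2]]; exists (g - s); by rewrite subKr; split=> //; exact: gsecB.
Qed.

Lemma cutrel_ge0 z : cutrel 0 z <-> (@GRing.zero T <= z).
Proof.
have zw : tau z = (wtau z)^v by []; set w := wtau z in zw *.
have [zD|zD] := boolP (inD w z).
  rewrite (cutrelD _ zD) /slt sub0r (posge_germN (inD_inC zD)) -(ge0_layer zw).
  by rewrite leNgt; split=> /negP.
have [dw nC] := notinD zw zD.
rewrite (cutrelN _ zw zD) /slt subr0 (posge_germN nC).
(* One direction is the gap of the layer. In the other, equality would give [ng w = w] and make [z]
   a unit. *)
have -> : (ng z < w^v) = (ng z <= ng w^v); last by rewrite le_ng ge0_layer.
apply/idP/idP => [|nzw]; first by apply: le0_layer; rewrite tau_ng.
have nw0 : ng w^v <= w^v := le_trans (ng_width_le0 w) (width_ge0 w).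
rewrite lt_neqAle (le_trans nzw nw0) andbT; apply/eqP => E.
case/negP: zD; have ngw : ng w^v = w^v by apply/le_anti; rewrite nw0 -{1}E nzw.
by apply: (@inDP _ _ _ (ng z)); rewrite ?tau_ng // add_ng zw.
Qed.

(** If just one of [x], [ng x] is a unit, a weak and a strict comparison with the same bound are
    complementary. If neither is, no element of [gsec] meets the bound. If both are, the layer is
    discrete, because a dense one would give [ng w = w]. *)
Lemma cutrel_opp s x : gsec s -> ng (tau x) <> tau x ->
  cutrel s (ng x) <-> ~ cutrel (- s) x.
Proof.
move=> sG nw; have xw : tau x = (wtau x)^v by []; set w := wtau x in xw *.
have nxw : tau (ng x) = w^v by rewrite tau_ng.
have DC : inD w x -> inD w (ng x) -> ~~ dense_width w.
  move=> xD nxD; apply/negP => dw; apply: nw; rewrite xw.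
  exact: inD_inC_ng xD (inD_inC nxD) dw.
have [xD|xD] := boolP (inD w x); have [nxD|nxD] := boolP (inD w (ng x)).
- have nd := DC xD nxD.
  rewrite (cutrelD _ xD) (cutrelD _ nxD).
  (* In a discrete layer the opposite of the cut above [g] is the cut below [- g], which is the cut
     above the predecessor of [- g]. *)
  have -> : germ w (ng x) = - germ w x - germ w (lone w).
    apply: (addrI (germ w x)); rewrite -germD ?inD_inC // laddE ?inD_inC // add_ng xw.
    rewrite -linv_lone // germN ?inD_inC ?inD_lone // addrA subrr sub0r //.
  set t := - germ w x - s.
  have tG : gsec t by apply: gsecB => //; apply/gsecN/gsec_germ.
  have E1 : slt (base w) (germ w x) (- s) <-> posge (base w) t.
    by rewrite /slt /t addrC.
  have E2 : slt (base w) (- germ w x - germ w (lone w)) s <->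
            posge (base w) (germ w (lone w) - t).
    by rewrite /slt /t !opprD !opprK addrC -addrA addrCA.
  rewrite E1 E2; split=> [H1 H2|H H2]; last first.
    by apply: H => H3; exact: (gsec_discrete nd tG H3).
  have one_gt0 : posge (base w) (germ w (lone w)).
    by rewrite posge_germ ?lone_gt // inD_inC // inD_lone.
  apply: H1; have [/H2 //|tN|t0] := posge_tricho (base w) (gsec_tame tG).
    exact: posge_add.
  by apply: posge_ext one_gt0 => k /t0; rewrite sec_sub => ->; rewrite subr0.
- rewrite (cutrelD _ xD) (cutrelN _ nxw nxD) ngK.
  rewrite -[in X in X <-> _](opprK s) slt_opp.
  by split=> [H|/contrapT].
- rewrite (cutrelD _ nxD) (cutrelN _ xw xD) slt_opp //.
- have [dw nxC] := notinD xw xD; have [_ xC] := notinD nxw nxD; rewrite ngK in xC.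
  rewrite (cutrelN _ nxw nxD) (cutrelN _ xw xD) ngK slt_opp.
  have E : - germ w x = germ w (ng x).
    apply/eqP; rewrite eq_sym -addr_eq0 -germD // /ladd dw addRC -tauE xw germ0 //.
  by rewrite E slt_gsec_generic.
Qed.

End CutRelation.

(** * The embedding *)

Lemma dom_leE (D : domType) (x y : dcar D) : sle (x : D) y <-> x + ng y <= ng 0.
Proof. by rewrite resid ngK dleE; split=> /asboolP. Qed.

Section CutEmbedding.
Context (D : domType).
Local Notation T := (dcar D).
Implicit Types (x y z : T) (w : width D).
Local Notation "w ^v" := (wval w) (at level 2, format "w ^v").

Definition wbot : width D := wtau 0.

Fact base_bot_le (i : idx D) : base wbot <= i.
Proof. by rewrite base_le wtau0_min. Qed.

Definition cut_group : orderedGroupType :=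
  section_group base_bot_le (@gsec_tame D) (@gsec0 D) (@gsecD D) (@gsecN D).

Definition gval (g : cut_group) : sections (layers D) :=
  sval (g : {s : sections (layers D) | gsec s}).

Lemma gvalP g : gsec (gval g).
Proof. exact: svalP (g : {s : sections (layers D) | gsec s}). Qed.

Lemma gval_ex s : gsec s -> exists g, gval g = s.
Proof. by move=> sG; exists (exist _ s sG). Qed.

Lemma gval_inj : injective gval.
Proof.
move=> g h; case: g h => [s ps] [t pt]; rewrite /gval /= => E; subst t.
by congr exist.
Qed.

Lemma gvalD g h : gval (g + h) = gval g + gval h. Proof. by []. Qed.
Lemma gvalN g : gval (- g) = - gval g. Proof. by []. Qed.
Lemma gval0 : gval 0 = 0. Proof. by []. Qed.

Lemma gval_ltP g h : g < h <-> slt (base wbot) (gval g) (gval h).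
Proof. exact: section_ltP. Qed.

Lemma cutrel_down x g h : g <= h -> cutrel (gval h) x -> cutrel (gval g) x.
Proof.
move=> gh; apply: (@cutrel_le _ (wtau x)) => //; try exact: gsec_tame (gvalP _).
move=> /(slt_le (base_bot_le _))/gval_ltP.
by rewrite og_ltNge gh.
Qed.

Section OneCut.
Context (x : T).
Let cutx : set cut_group := [set g | cutrel (gval g) x].

Fact cut_of_lt g h : cutx g -> (~` cutx) h -> g < h.
Proof.
move=> gx hx; rewrite og_ltNge; apply/negP => hg; apply: hx.
exact: cutrel_down gx.
Qed.

Definition cut_of : cut cut_group := Cut (setUv cutx) (setICr cutx) cut_of_lt.
End OneCut.

Lemma cut_ofL x g : cutL (cut_of x) g <-> cutrel (gval g) x.
Proof. by []. Qed.

Lemma cut_of_add x y : cut_of (x + y) = cut_add (cut_of x) (cut_of y).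
Proof.
apply: cut_eq => g; rewrite cut_addL cut_ofL (cutrel_add _ _ (gvalP g)).
split=> [[s [/gval_ex[h <-] sx sy]]|[h hx hy]]; first by exists h.
by exists (gval h); split=> //; exact: gvalP.
Qed.

Lemma cut_of_opp x : ng (tau x) <> tau x -> cut_of (ng x) = cut_opp (cut_of x).
Proof.
move=> nx; apply: cut_eq => g.
by rewrite cut_oppL !cut_ofL gvalN (cutrel_opp (gvalP g) nx).
Qed.

Lemma inD_wbot0 : inD wbot (0 : T).
Proof. by have := inD_width wbot; rewrite /= tau0. Qed.

Lemma germ_wbot0 : germ wbot (0 : T) = 0.
Proof. by have := germ0 wbot; rewrite /= tau0. Qed.

Lemma cut_of0 : cut_of 0 = cut_zero.
Proof.
apply: cut_eq => g; rewrite cut_ofL (cutrelD _ inD_wbot0) germ_wbot0 /=.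
by rewrite -gval0 -gval_ltP og_ltNge; split=> [/negP/negPn|/negPn/negP].
Qed.

Lemma cut_of_ge0 z : cutL (cut_of z) 0 <-> (0 : T) <= z.
Proof. by rewrite cut_ofL gval0 cutrel_ge0. Qed.

Lemma ng_tau_neq x : ng 0 <> 0 :> T -> ng (tau x) <> tau x.
Proof. by move=> n0 /(@ng_width_eq _ (wtau x))[_]. Qed.

Lemma hat_embedding : ng 0 <> 0 :> T ->
  is_embedding (cut_of : D -> hat cut_group).
Proof.
move=> n0; have fN x : cut_of (ng x) = cut_opp (cut_of x).
  exact/cut_of_opp/ng_tau_neq.
(* As [ng 0 < 0], the gap [ge0_or] makes [z <= ng 0] the negation of [0 <= z]. *)
have dl z : z <= ng 0 <-> cut_le (cut_of z) (cut_opp cut_zero).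
  rewrite cut_le_delta cut_of_ge0; split=> [zd z0|/negP].
    apply: n0; apply/le_anti; rewrite ng0_le0 /=; exact: le_trans zd.
  by case: (ge0_or z) => // ->.
split=> [x y|||].
- by rewrite dom_leE dl cut_of_add fN cut_add_delta cut_oppK.
- exact: cut_of0.
- exact: cut_of_add.
- exact: fN.
Qed.

Lemma cut_group_discrete : ~~ dense_width wbot -> discretely_ordered cut_group.
Proof.
move=> nd; have [e eE] := gval_ex (gsec_germ (inD_lone nd)).
exists e; split=> [|g].
  rewrite gval_ltP eE /slt subr0 posge_germ ?lone_gt //.
  exact/inD_inC/inD_lone.
rewrite og_leNgt gval_ltP /slt subr0 => g0; apply/negP.
by rewrite gval_ltP eE => /(gsec_discrete nd (gvalP g) g0).
Qed.

(** The germ of [wbot] is 0, so [dense_approx] with [c = wbot] produces a positive section smaller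
    than [h - g]. *)
Lemma cut_group_dense : dense_width wbot -> densely_ordered cut_group.
Proof.
move=> dw g h; rewrite gval_ltP => gh.
have dG : gsec (gval h - gval g) by apply: gsecB; exact: gvalP.
have [_ d0 _] := dG.2 wbot.
have [n] := dense_approx dw (inC_width wbot) (gsec_tame dG) d0 gh.
rewrite germ0 subr0 => -[e1 e2].
have [e eE] := gval_ex (gsec_const n 1 dw (inC_width wbot)).
exists (g + e); rewrite !gval_ltP /slt gvalD eE; split.
  by rewrite addrAC subrr add0r.
by rewrite opprD addrA.
Qed.

(** When [ng 0 = 0], the elements of width 0, which [cutrel_opp] leaves out, go to group elements,
    and all others to cuts. *)
Definition tilde_of (x : T) : cut_group + cut cut_group :=
  if pselect (inD wbot x) is left xD then
    inl (exist _ (germ wbot x) (gsec_germ xD)) else inr (cut_of x).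

Lemma tilde_embedding : ng 0 = 0 :> T -> is_embedding (tilde_of : D -> tilde cut_group).
Proof.
move=> n0.
have bot0 : wbot^v = 0 by rewrite /= tau0.
have Dbot x : inD wbot x = (tau x == 0).
  apply/idP/eqP => [/inD_tau->//|x0].
  apply: (@inDP _ _ _ (ng x)); rewrite ?tau_ng bot0 //.
  by rewrite add_ng x0 n0.
have Dle x : tau x <= 0 -> inD wbot x.
  by rewrite Dbot => x0; apply/eqP/le_anti; rewrite x0 tau_ge0.
have DD x y : inD wbot (x + y) = inD wbot x && inD wbot y.
  apply/idP/andP => [|[]]; last exact: inD_add.
  rewrite Dbot tau_add => /eqP E.
  by split; apply: Dle; rewrite -E le_max lexx ?orbT.
have DN x : inD wbot (ng x) = inD wbot x by rewrite !Dbot tau_ng.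
have ofD x : inD wbot x -> exists2 g, tilde_of x = inl g & gval g = germ wbot x.
  by move=> xD; rewrite /tilde_of; case: pselect => // xD'; eexists.
have ofN x : ~~ inD wbot x -> tilde_of x = inr (cut_of x).
  by move=> /negP xD; rewrite /tilde_of; case: pselect.
have germDN x : inD wbot x -> germ wbot (ng x) = - germ wbot x.
  move=> xD; rewrite -germN ?inD_inC //; congr (germ _ _).
  by rewrite /linv bot0 n0 addr0.
have fN x : tilde_of (ng x) = tilde_opp (tilde_of x).
  have [xD|xD] := boolP (inD wbot x).
    have [g -> gE] := ofD _ xD; have [h -> hE] := ofD (ng x) (etrans (DN x) xD).
    by congr inl; apply: gval_inj; rewrite hE gvalN gE germDN.
  rewrite (ofN _ xD) ofN ?DN //; congr inr; apply: cut_of_opp => E.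
  have [/(congr1 wval)/= E' _] := @ng_width_eq _ (wtau x) E.
  by move: xD; rewrite Dbot E' tau0 eqxx.
have shift x y g : inD wbot x -> gval g = germ wbot x ->
    cut_of (x + y) = cut_shift g (cut_of y).
  move=> xD gE; rewrite cut_of_add; apply: cut_eq => h.
  rewrite cut_shiftL cut_addL; split=> [[k]|H]; last first.
    by exists g => //; apply/(cutrelD _ xD); rewrite gE; exact: slt_irr.
  rewrite cut_ofL (cutrelD _ xD) -gE -gval_ltP og_ltNge => /negP/negPn kg.
  apply: cutrel_down; by rewrite og_leD2l og_leN2.
have fD x y : tilde_of (x + y) = tilde_add (tilde_of x) (tilde_of y).
  have [xD|xD] := boolP (inD wbot x); have [yD|yD] := boolP (inD wbot y).
  - have [g -> gE] := ofD _ xD; have [h -> hE] := ofD _ yD.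
    have [k -> kE] := ofD _ (inD_add xD yD); congr inl; apply: gval_inj.
    by rewrite kE gvalD gE hE -germD ?inD_inC // laddE ?inD_inC.
  - have [g -> gE] := ofD _ xD; rewrite (ofN _ yD) ofN ?DD ?(negbTE yD) ?andbF //.
    by congr inr; exact: shift.
  - have [g -> gE] := ofD _ yD; rewrite (ofN _ xD) ofN ?DD ?(negbTE xD) //.
    by congr inr; rewrite addrC; exact: shift.
  - rewrite (ofN _ xD) (ofN _ yD) ofN ?DD ?(negbTE xD) //.
    by congr inr; exact: cut_of_add.
have f0 : tilde_of 0 = inl 0.
  have [g -> gE] := ofD _ inD_wbot0; congr inl; apply: gval_inj.
  by rewrite gE germ_wbot0.
suff fle (x y : T) : sle (x : D) y <-> sle (tilde_of x : tilde cut_group) (tilde_of y).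
  by split.
have [td1 t0] := @tilde_dom1 cut_group.
(* The target is itself a dom of the first type, so its order too reduces to a comparison with 0. *)
have leE (a b : tilde cut_group) : sle a b <-> sle (sadd a (sopp b)) (inl 0 : tilde _).
  have /= := @dom_leE (DomType td1) a b; rewrite dleE => ->.
  have -> : ng (@GRing.zero (dcar (DomType td1))) = inl 0 := t0.
  by split=> /asboolP.
have subE : sadd (tilde_of x : tilde cut_group) (sopp (tilde_of y : tilde cut_group)) =
    tilde_of (x + ng y) by rewrite fD fN.
rewrite dom_leE leE subE n0; move: (x + ng y) => z.
have [zD|zD] := boolP (inD wbot z).
  have [g -> gE] := ofD _ zD; have gle : (g <= 0) <-> ~ 0 < g.
    by rewrite og_leNgt; split=> /negP.
  rewrite (_ : sle _ _ = (g <= 0)) // gle gval_ltP gE /slt subr0.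
  by rewrite posge_germ ?inD_inC // bot0 leNgt; split=> /negP.
rewrite (ofN _ zD) (_ : sle _ _ = cutR (cut_of z) 0) // cutRE cut_of_ge0; split=> [z0 z0'|/negP z0].
  by move: zD; rewrite (_ : z = 0) ?inD_wbot0 //; apply/le_anti; rewrite z0.
by rewrite leNgt; apply: contra z0 => /ltW.
Qed.

End CutEmbedding.

(** * The three types of doms *)

Lemma hat_embedding_dom2 (M : structure) : is_dom2 M ->
  exists G : orderedGroupType, discretely_ordered G /\
    exists f : M -> hat G, is_embedding f.
Proof.
move=> [HM [_ dd]]; pose D := DomType HM; exists (cut_group D).
have nd : ~~ dense_width (wbot D).
  apply/negP => /eqP; rewrite /= tau0 /addR => /(congr1 ng); rewrite ngK => E.
  exact: dd E.
split; first exact: cut_group_discrete.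
exists (@cut_of D); apply: (@hat_embedding D) => n0.
by apply: dd; rewrite /sdelta [sopp _]n0; exact: predom_add0 (dom_predom HM) _.
Qed.

Lemma hat_embedding_dom3 (M : structure) : is_dom3 M ->
  exists G : orderedGroupType, densely_ordered G /\
    exists f : M -> hat G, is_embedding f.
Proof.
move=> [HM dd [_ d0]]; pose D := DomType HM; exists (cut_group D).
split; last by exists (@cut_of D); exact: (@hat_embedding D).
apply: cut_group_dense; apply/eqP; rewrite /= tau0 /addR.
by rewrite -[RHS]ngK; congr ng; exact: dd.
Qed.

Lemma tilde_embedding_dom1 (M : structure) : is_dom1 M ->
  exists G : orderedGroupType, exists f : M -> tilde G, is_embedding f.
Proof.
move=> [HM d0]; pose D := DomType HM; exists (cut_group D), (@tilde_of D).
exact: (@tilde_embedding D).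
Qed.

Theorem mainTheorem1 :
  [/\ axiomatizes_universal_part dom1_theory
        (fun M : structure => exists G : orderedGroupType, M = tilde G) /\
      (forall M : structure, is_dom1 M ->
         exists (G : orderedGroupType) (A : substructure (tilde G)),
           isomorphic M (sub_structure A)),
      axiomatizes_universal_part dom2_theory
        (fun M : structure => exists2 G : orderedGroupType,
           discretely_ordered G & M = hat G) /\
      (forall M : structure, is_dom2 M ->
         exists G : orderedGroupType, discretely_ordered G /\
           exists A : substructure (hat G), isomorphic M (sub_structure A))
    & axiomatizes_universal_part dom3_theory
        (fun M : structure => exists2 G : orderedGroupType,
           densely_ordered G & M = hat G) /\
      (forall M : structure, is_dom3 M ->
         exists G : orderedGroupType, densely_ordered G /\
           exists A : substructure (hat G), isomorphic M (sub_structure A))].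
Proof.
have iso (M N : structure) (f : M -> N) : is_predom M -> is_predom N -> is_embedding f ->
    exists A : substructure N, isomorphic M (sub_structure A).
  by move=> HM HN Hf; apply: (embedding_image Hf (predom_embedding_inj HM HN Hf)).
split; split.
- apply: (universal_partP dom1_theoryP) => [M [/dom_predom]//|_ [G ->]|M].
    exact: tilde_dom1.
  by move=> /tilde_embedding_dom1[G Hf]; exists (tilde G) => //; exists G.
- move=> M HM; have [G [f Hf]] := tilde_embedding_dom1 HM; exists G.
  exact: iso (dom_predom HM.1) tilde_predom Hf.
- apply: (universal_partP dom2_theoryP) => [M [/dom_predom]//|_ [G Gd ->]|M].
    exact: hat_dom2.
  by move=> /hat_embedding_dom2[G [Gd Hf]]; exists (hat G) => //; exists G.
- move=> M HM; have [G [Gd [f Hf]]] := hat_embedding_dom2 HM; exists G; split=> //.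
  exact: iso (dom_predom HM.1) hat_predom Hf.
- apply: (universal_partP dom3_theoryP) => [M [/dom_predom]//|_ [G Gd ->]|M].
    exact: hat_dom3.
  by move=> /hat_embedding_dom3[G [Gd Hf]]; exists (hat G) => //; exists G.
- move=> M HM; have [G [Gd [f Hf]]] := hat_embedding_dom3 HM; exists G; split=> //.
  by case: HM => HM _ _; exact: iso (dom_predom HM) hat_predom Hf.
Qed.
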